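(* Let $n\ge 2$. Assume that $D\subsetneq\mathbb{R}^n$ is an unbounded $c$-John domain and that $0<s<1$, $$1<p\le q\le\frac{np}{n-sp}<\infty,$$ and $\beta\in\mathbb{R}$ are such that $$\dim_A(\partial D)<\min\left\{\frac qp(n-sp+\beta),\ n-\frac{\beta}{p-1}\right\}.$$ In addition, let $\tau\in(0,1)$. Then there is a constant $C=C(\beta,\tau,n,c,s,p,q)>0$, depending at most on the indicated parameters, such that the inequality $$\left(\int_D|u(x)|^q\,\delta_{\partial D}(x)^{(q/p)(n-sp+\beta)-n}\,dx\right)^{p/q}\le C\int_D\int_{B(x,\tau\delta_{\partial D}(x))}\frac{|u(x)-u(y)|^p}{|x-y|^{n+sp}}\,dy\,\delta_{\partial D}(x)^\beta\,dx$$ holds for all $u\in\bigcup_{1\le r<\infty}L^r(D)$.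
   Context: $B(x,r)$ is the open ball in $\mathbb{R}^n$ with center $x$ and radius $r$, and $\delta_{\partial D}(x)=\operatorname{dist}(x,\partial D)$. A domain is an open connected set. For $c\ge1$, a domain $D\subsetneq\mathbb{R}^n$, $n\ge2$, is a $c$-John domain if each pair of points $x_1,x_2\in D$ can be joined by a rectifiable arc length parametrized curve $\gamma:[0,\ell]\to D$ (that is, $\gamma(0)=x_1$, $\gamma(\ell)=x_2$) satisfying $\operatorname{dist}(\gamma(t),\partial D)\ge\min\{t,\ell-t\}/c$ for every $t\in[0,\ell]$. For $E\subset\mathbb{R}^n$, the Assouad dimension $\dim_A(E)$ is the infimum of the exponents $\alpha\ge0$ for which there is a constant $C\ge1$ such that for each $x\in E$ and every $0<r<R$, the set $E\cap B(x,R)$ can be covered by at most $C(r/R)^{-\alpha}$ balls of radius $r$.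
   Formalization: The constant C may depend, besides β, τ, n, c, s, p, q, on an exponent α below the stated minimum and a constant K for which the Assouad covering property of ∂D holds; with C depending only on the listed parameters the claim fails (complements of finite sets in the plane). *)

(* Defs.v *)
From HB Require Import structures.
From mathcomp Require Import all_boot all_order all_algebra.
From mathcomp Require Import all_classical all_reals all_analysis.
Set Implicit Arguments.
Unset Strict Implicit.
Unset Printing Implicit Defensive.
Import Order.TTheory GRing.Theory Num.Theory.
Import numFieldNormedType.Exports.
Local Open Scope classical_set_scope.
Local Open Scope ring_scope.

(* R^n is 'rV[R]_n.  The library's topology on it is the usual one, but its
   norm `|x| is the sup norm; distances, balls, lengths and integrands below all
   use the Euclidean norm enorm. *)
Section euclidean.
Context {R : realType} {n : nat}.
Implicit Types (x y : 'rV[R]_n) (E : set 'rV[R]_n).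

Definition enorm x : R := Num.sqrt (\sum_(i < n) (x 0 i) ^+ 2).

Definition eball x (r : R) : set 'rV[R]_n := [set y | enorm (y - x) < r].

Definition boundary E : set 'rV[R]_n := closure E `\` interior E.

(* [inf] of the empty set is 0; the boundary of a nonempty proper subset of R^n
   is nonempty. *)
Definition dist_to E x : R := inf [set enorm (x - y) | y in E].

Definition delta_bd E x : R := dist_to (boundary E) x.

(* Assouad covering property with exponent alpha and constant K. *)
Definition assouad_cover E (alpha K : R) : Prop :=
  forall x (r r' : R), E x -> 0 < r -> r < r' ->
  exists2 s : seq 'rV[R]_n,
    (size s)%:R <= K * (r / r') `^ (- alpha) &
    forall y, E y -> eball x r' y -> exists2 z, z \in s & eball z r y.

Definition assouad_dim E : \bar R :=
  ereal_inf [set alpha%:E | alpha in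
    [set a : R | 0 <= a /\ exists2 K : R, 1 <= K & assouad_cover E a K]].

(* Length of gamma on [a, b], the supremum over partitions a < t1 < ... < b. *)
Definition curve_length (gamma : R -> 'rV[R]_n) (a b : R) : \bar R :=
  ereal_sup [set (\sum_(i < size s)
    enorm (gamma (nth b (a :: s) i.+1) - gamma (nth b (a :: s) i)))%:E
    | s in [set s | itv_partition a b s]].

(* Since l is finite, such a curve is rectifiable. *)
Definition arc_length_parametrized (gamma : R -> 'rV[R]_n) (l : R) : Prop :=
  {within `[0, l], continuous gamma} /\
  forall t : R, 0 <= t <= l -> curve_length gamma 0 t = t%:E.

Definition domain E : Prop := open E /\ connected E.

Definition john_domain (c : R) E : Prop :=
  [/\ domain E, E <> setT &
    forall x1 x2, E x1 -> E x2 ->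
    exists (l : R) (gamma : R -> 'rV[R]_n),
      [/\ 0 <= l, gamma 0 = x1 /\ gamma l = x2,
          arc_length_parametrized gamma l,
          forall t : R, 0 <= t <= l -> E (gamma t) &
          forall t : R, 0 <= t <= l ->
            Num.min t (l - t) / c <= delta_bd E (gamma t)]].

End euclidean.

(* Borel sigma-algebra of R^n, as the product sigma-algebra. *)
Section measurable_row.
Context {R : realType}.

Definition row_gen n : set (set 'rV[R]_n) :=
  \bigcup_(i in [set: 'I_n])
    preimage_set_system setT (fun x : 'rV[R]_n => x 0 i) measurable.

Definition row_measurable n : set (set 'rV[R]_n) := <<s @row_gen n >>.

Fact row_display : measure_display. Proof. exact: default_measure_display. Qed.

Section instance.
Variable n : nat.

Let row0 : @row_measurable n set0.
Proof. exact: sigma_algebra0. Qed.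

Let rowC A : @row_measurable n A -> @row_measurable n (~` A).
Proof. exact: sigma_algebraC. Qed.

Let row_bigcup (F : (set 'rV[R]_n)^nat) : (forall i, row_measurable (F i)) ->
  row_measurable (\bigcup_i F i).
Proof. exact: sigma_algebra_bigcup. Qed.

HB.instance Definition _ :=
  @isMeasurable.Build row_display 'rV[R]_n (@row_measurable n) row0 rowC row_bigcup.

End instance.

Lemma measurable_coord n (i : 'I_n) :
  measurable_fun setT (fun x : 'rV[R]_n => x 0 i).
Proof.
move=> _ B mB; rewrite setTI; apply: sub_sigma_algebra.
by exists i => //; exists B => //; rewrite setTI.
Qed.

Lemma measurable_row d (T : measurableType d) n (f : T -> 'rV[R]_n) :
  (forall i, measurable_fun setT (fun x => f x 0 i)) -> measurable_fun setT f.
Proof.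
move=> mf; apply: (@measurability _ _ _ _ _ _ (@row_gen n)) => //.
move=> _ [_ [i _ [B mB <-]] <-].
by rewrite !setTI -[X in measurable X]setTI; exact: (mf i).
Qed.

End measurable_row.

(* n-dimensional Lebesgue measure, by recursion through R^(n+1) = R * R^n. *)
Section lebesgue_row.
Context {R : realType}.

Section step.
Variable n : nat.
Variable mu : {sigma_finite_measure set 'rV[R]_n -> \bar R}.

Definition row_cons (z : measurableTypeR R * 'rV[R]_n) : 'rV[R]_n.+1 :=
  \row_i oapp (fun j => z.2 0 j) z.1 (unlift ord0 i).

Definition row_uncons (v : 'rV[R]_n.+1) : measurableTypeR R * 'rV[R]_n :=
  (v 0 ord0, \row_j v 0 (lift ord0 j)).

Lemma row_cons0 z : row_cons z 0 ord0 = z.1.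
Proof. by rewrite mxE unlift_none. Qed.

Lemma row_consS z j : row_cons z 0 (lift ord0 j) = z.2 0 j.
Proof. by rewrite mxE liftK. Qed.

Lemma row_consK : cancel row_cons row_uncons.
Proof.
move=> [a v]; rewrite /row_uncons row_cons0; congr pair.
by apply/rowP => j; rewrite mxE row_consS.
Qed.

Lemma measurable_row_cons : measurable_fun setT row_cons.
Proof.
apply: measurable_row => i; case: (unliftP ord0 i) => [j ->|->].
  under eq_fun do rewrite row_consS.
  by apply: (@measurableT_comp _ _ _ _ _ _ (fun x : 'rV[R]_n => x 0 j));
    [exact: measurable_coord|exact: measurable_snd].
under eq_fun do rewrite row_cons0.
exact: measurable_fst.
Qed.

Lemma measurable_row_uncons : measurable_fun setT row_uncons.
Proof.
apply: measurable_fun_pair; first exact: measurable_coord.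
apply: measurable_row => i; under eq_fun do rewrite mxE.
exact: measurable_coord.
Qed.

Local Notation leb :=
  (@lebesgue_measure R : {sigma_finite_measure set (measurableTypeR R) -> \bar R}).

Definition lebesgue_step (A : set 'rV[R]_n.+1) : \bar R :=
  pushforward (leb \x mu)%E row_cons A.

Let step0 : lebesgue_step set0 = 0%E.
Proof. by rewrite /lebesgue_step /pushforward preimage_set0 measure0. Qed.

Let step_ge0 A : (0 <= lebesgue_step A)%E.
Proof. by rewrite /lebesgue_step /pushforward; exact: measure_ge0. Qed.

Let step_sigma_additive : semi_sigma_additive lebesgue_step.
Proof.
have mpre A : measurable A -> measurable (row_cons @^-1` A).
  by move=> mA; rewrite -[X in measurable X]setTI; exact: measurable_row_cons.
move=> F mF tF mUF; rewrite /lebesgue_step /pushforward preimage_bigcup.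
apply: measure_semi_sigma_additive.
- by move=> k; exact: mpre.
- apply/trivIsetP => /= i j _ _ ij; rewrite -preimage_setI.
  by move/trivIsetP : tF => /(_ _ _ _ _ ij) ->//; rewrite preimage_set0.
- by rewrite -preimage_bigcup; exact: mpre.
Qed.

HB.instance Definition _ := isMeasure.Build _ _ _
  lebesgue_step step0 step_ge0 step_sigma_additive.

Let step_sigma_finite : sigma_finite setT lebesgue_step.
Proof.
have /sigma_finiteP[F [FT ndF Foo]] := sigma_finiteT leb.
have /sigma_finiteP[G [GT ndG Goo]] := sigma_finiteT mu.
have FGT : \bigcup_k (F k `*` G k) = setT.
  rewrite -setXTT FT GT predeqE => -[x y]; split.
    by move=> [k _ []/= ? ?]; split; exists k.
  move=> [/= [k _ Fkx] [j _ Gjy]]; exists (maxn k j) => //; split.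
  - by move: x Fkx; exact/subsetPset/ndF/leq_maxl.
  - by move: y Gjy; exact/subsetPset/ndG/leq_maxr.
exists (fun k => row_uncons @^-1` (F k `*` G k)).
  by rewrite -preimage_bigcup FGT preimage_setT.
move=> k; have [mF Fk] := Foo k; have [mG Gk] := Goo k; split.
  rewrite -[X in measurable X]setTI; apply: measurable_row_uncons => //.
  exact: measurableX.
rewrite /lebesgue_step /pushforward -comp_preimage.
rewrite (_ : row_uncons \o row_cons = id); last exact/funext/row_consK.
by rewrite preimage_id product_measure1E// lte_mul_pinfty// ge0_fin_numE.
Qed.

HB.instance Definition _ := Measure_isSigmaFinite.Build _ _ _
  lebesgue_step step_sigma_finite.

End step.

Fixpoint lebesgue_row n : {sigma_finite_measure set 'rV[R]_n -> \bar R} :=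
  match n with
  | 0%N => [the {sigma_finite_measure set _ -> \bar R} of \d_(0 : 'rV[R]_0)]
  | k.+1 => [the {sigma_finite_measure set _ -> \bar R} of
              lebesgue_step (lebesgue_row k)]
  end.

Lemma lebesgue_row_box n (a b : 'I_n -> R) : (forall i, a i <= b i) ->
  lebesgue_row n [set x | forall i, a i < x 0 i <= b i] =
  (\prod_(i < n) (b i - a i))%:E.
Proof.
elim: n a b => [|n IH] a b ab.
  rewrite big_ord0 /= diracE; case: (boolP (_ \in _)) => // /negP[].
  by apply/mem_set => -[].
rewrite /= /lebesgue_step /pushforward.
rewrite (_ : _ @^-1` _ = `]a ord0, b ord0] `*`
    [set x : 'rV[R]_n | forall i, a (lift ord0 i) < x 0 i <= b (lift ord0 i)]).
  have mbox : measurable [set x : 'rV[R]_n |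
      forall i, a (lift ord0 i) < x 0 i <= b (lift ord0 i)].
    rewrite (_ : [set x | _] = \bigcap_(i in [set: 'I_n])
      ((fun x : 'rV[R]_n => x 0 i) @^-1` `]a (lift ord0 i), b (lift ord0 i)])).
      apply: fin_bigcap_measurable => [|i _]; first exact: finite_finset.
      by rewrite -[X in measurable X]setTI; exact: measurable_coord.
    apply/seteqP; split => x /= H i.
      by move=> _; have := H i; rewrite /= in_itv.
    by have := H i I; rewrite /= in_itv.
  rewrite product_measure1E//.
  rewrite IH; last by move=> i; exact: ab.
  rewrite big_ord_recl EFinM; congr (_ * _)%E.
  transitivity (lebesgue_measure (`]a ord0, b ord0] : set R)); first by [].
  rewrite lebesgue_measure_itv /= lte_fin.
  by have := ab ord0; rewrite le_eqVlt => /orP[/eqP->|->//]; rewrite ltxx subrr.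
apply/seteqP; split => [z /= H|z /= [H0 HS] i].
  split=> [|i]; first by have := H ord0; rewrite row_cons0 /= in_itv.
  by rewrite -row_consS; exact: H.
case: (unliftP ord0 i) => [j ->|->]; rewrite ?row_consS ?row_cons0.
  exact: HS.
by move: H0; rewrite /= in_itv.
Qed.

End lebesgue_row.

(* u represents an element of L^r(D). *)
Definition in_Lr {R : realType} {n : nat} (D : set 'rV[R]_n) (r : R)
    (u : 'rV[R]_n -> R) : Prop :=
  measurable_fun D u /\ finite_norm (lebesgue_row n) r%:E (u \_ D).

(* Main.v *)
(* Write G for the inner integral of the right-hand side, so that the
   right-hand side is Lam = int_D G delta^beta, and dw for
   (q/p)(n - sp + beta).  If |a - b| < tau delta(a) and |a - b| <= C t for all
   points a, b of two boxes of side about t, then the averages of |u| over the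
   boxes differ by at most a multiple of t^(s - n/p) (int G)^(1/p), the integral
   being over the first box.

   Near x one passes from a small box centred at x to one of side about
   delta(x), starting at the scale r with r^n G(x) delta(x)^beta = Lam.  There
   int G <= delta^(-beta) Lam and the pointwise value G(x) give the same bound,
   and since q <= np/(n - sp) this local part is at most
   (Lam^(q/p - 1) G(x) delta(x)^(beta + n - dw))^(1/q).

   Away from x, the John curve from x to a far point of D yields one box of side
   about t_i = h^i delta(x) for every i, so |u| averaged near x is at most
   sum_i t_i^(-dw/q) E_i^(1/p) with E_i = int_(box i) G delta^beta, the last
   average being negligible because u is in L^r.  For alpha < a < dw,
   E_i <= min(Lam, t_i^a P(x)), where P(x) is the integral of
   G delta^(beta - a) over the points z with |x - z| and delta(x) at most
   8 c delta(z); the series becomes geometric with sum at most a multiple of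
   (Lam^(q/p - 1) P(x) delta(x)^(a - dw))^(1/q).

   Integrating the q-th powers, by Tonelli it remains to bound
   int delta(x)^(a - n) dx over |x - z|, delta(x) <= t = 8 c delta(z) by a
   multiple of t^a; this is where the Assouad covering of the boundary, applied
   to the dyadic levels of delta, is used. *)
Require Import Defs.
From mathcomp Require Import all_boot all_order all_algebra.
From mathcomp Require Import all_classical all_reals all_analysis.
From mathcomp Require Import measurable_realfun.
From mathcomp Require Import ring lra.
Import Order.TTheory GRing.Theory Num.Theory.
Import numFieldNormedType.Exports.
Local Open Scope classical_set_scope.
Local Open Scope ring_scope.

Set Implicit Arguments.
Unset Strict Implicit.
Unset Printing Implicit Defensive.

(** * Euclidean norm and distance to the boundary *)

Section EuclideanNorm.
Context {R : realType} {n : nat}.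
Implicit Types x y z : 'rV[R]_n.

Lemma enorm_ge0 x : 0 <= enorm x.
Proof. exact: sqrtr_ge0. Qed.

Lemma enorm0 : enorm (0 : 'rV[R]_n) = 0.
Proof.
by rewrite /enorm big1 ?sqrtr0// => i _; rewrite mxE expr0n.
Qed.

Lemma sqr_enorm x : enorm x ^+ 2 = \sum_(i < n) (x 0 i) ^+ 2.
Proof. by rewrite sqr_sqrtr// sumr_ge0// => i _; exact: sqr_ge0. Qed.

Lemma enormN x : enorm (- x) = enorm x.
Proof.
by congr Num.sqrt; apply: eq_bigr => i _; rewrite mxE sqrrN.
Qed.

Lemma enormB x y : enorm (x - y) = enorm (y - x).
Proof. by rewrite -opprB enormN. Qed.

Lemma enormZ (a : R) x : enorm (a *: x) = `|a| * enorm x.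
Proof.
rewrite -sqrtr_sqr -sqrtrM ?sqr_ge0//; congr Num.sqrt.
by rewrite mulr_sumr; apply: eq_bigr => i _; rewrite mxE exprMn.
Qed.

Lemma ler_coord_enorm x i : `|x 0 i| <= enorm x.
Proof.
rewrite -(@ler_pXn2r _ 2)// ?nnegrE ?enorm_ge0//.
rewrite sqr_enorm real_normK ?num_real// (bigD1 i)//= lerDl.
by rewrite sumr_ge0// => j _; exact: sqr_ge0.
Qed.

Lemma enorm_eq0 x : enorm x = 0 -> x = 0.
Proof.
move=> x0; apply/rowP => i; apply/eqP; rewrite mxE -normr_le0 -x0.
exact: ler_coord_enorm.
Qed.

Lemma enorm_gt0 x : x != 0 -> 0 < enorm x.
Proof.
by move=> x0; rewrite lt_neqAle enorm_ge0 eq_sym andbT; apply: contra x0 => /eqP/enorm_eq0 ->.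
Qed.

Lemma cauchy_schwarz x y :
  \sum_(i < n) x 0 i * y 0 i <= enorm x * enorm y.
Proof.
have [->|x0] := eqVneq x 0.
  by rewrite enorm0 mul0r big1// => i _; rewrite mxE mul0r.
have [->|y0] := eqVneq y 0.
  by rewrite enorm0 mulr0 big1// => i _; rewrite mxE mulr0.
have X0 := enorm_gt0 x0; have Y0 := enorm_gt0 y0.
rewrite -(@ler_pM2l _ (2 * (enorm x * enorm y))) ?mulr_gt0// mulr_sumr.
have -> : 2 * (enorm x * enorm y) * (enorm x * enorm y) =
  enorm y ^+ 2 * (enorm x ^+ 2) + enorm x ^+ 2 * (enorm y ^+ 2) by ring.
rewrite [X in _ * X + _]sqr_enorm [X in _ + _ * X]sqr_enorm !mulr_sumr -big_split /=.
apply: ler_sum => i _; rewrite -subr_ge0.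
rewrite (_ : _ - _ = (enorm y * x 0 i - enorm x * y 0 i) ^+ 2) ?sqr_ge0//.
by ring.
Qed.

Lemma ler_enormD x y : enorm (x + y) <= enorm x + enorm y.
Proof.
rewrite -(@ler_pXn2r _ 2)// ?nnegrE ?addr_ge0 ?enorm_ge0//.
rewrite sqr_enorm sqrrD !sqr_enorm.
under eq_bigr do rewrite mxE sqrrD.
rewrite !big_split /= lerD2r lerD2l -mulr2n.
by rewrite lerMn2r; exact: cauchy_schwarz.
Qed.

Lemma ler_enormB x y z : enorm (x - y) <= enorm (x - z) + enorm (z - y).
Proof. by have := ler_enormD (x - z) (z - y); rewrite addrA subrK. Qed.

Lemma enorm_le_sum x : enorm x <= \sum_(i < n) `|x 0 i|.
Proof.
have S0 : 0 <= \sum_(i < n) `|x 0 i| by exact: sumr_ge0.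
rewrite -(@ler_pXn2r _ 2)// ?nnegrE ?enorm_ge0// sqr_enorm expr2 mulr_suml.
apply: ler_sum => i _; rewrite -real_normK ?num_real// expr2 ler_wpM2l//.
by rewrite (bigD1 i)//= lerDl sumr_ge0.
Qed.

End EuclideanNorm.

(** * Open sets, distance to a set, and segments leaving an open set *)

Section Topology.
Context {R : realType} {n : nat}.
Implicit Types (x y z : 'rV[R]_n) (E : set 'rV[R]_n).

Lemma norm_le_enorm x : `|x| <= enorm x.
Proof.
have [->|] := eqVneq `|x| 0; first exact: enorm_ge0.
by move=> /mx_norm_neq0[[i j]]; rewrite -[leLHS]/(mx_norm x) => -> /=;
  rewrite ord1 ler_coord_enorm.
Qed.

Lemma coord_le_norm x i : `|x 0 i| <= `|x|.
Proof.
rewrite -[leRHS]/(mx_norm x) mx_normrE.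
exact: (@le_bigmax _ _ _ 0 (fun ij : 'I_1 * 'I_n => `|x ij.1 ij.2|) (0, i)).
Qed.

Lemma enorm_le_norm x : enorm x <= n%:R * `|x|.
Proof.
apply: le_trans (enorm_le_sum x) _.
rewrite mulr_natl -[X in _ *+ X]card_ord -sumr_const; apply: ler_sum => i _.
exact: coord_le_norm.
Qed.

Lemma nbhs_eball x E : nbhs x E -> exists2 r : R, 0 < r & eball x r `<=` E.
Proof.
move=> /nbhs_ballP[r /= r0 rE]; exists r => // y xy; apply: rE.
rewrite -ball_normE /=; apply: le_lt_trans (norm_le_enorm _) _.
by rewrite enormB.
Qed.

Lemma eball_nbhs x (r : R) : 0 < r -> nbhs x (eball x r).
Proof.
move=> r0; apply/nbhs_ballP; exists (r / n.+1%:R) => /=; first by rewrite divr_gt0.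
move=> y; rewrite -ball_normE /= => xy; rewrite /eball /= enormB.
apply: le_lt_trans (enorm_le_norm _) _.
apply: (@le_lt_trans _ _ (n.+1%:R * `|x - y|)); first by rewrite ler_wpM2r// ler_nat.
by rewrite mulrC -ltr_pdivlMr.
Qed.

Lemma open_eball x E : open E -> E x -> exists2 r : R, 0 < r & eball x r `<=` E.
Proof. by move=> oE Ex; apply: nbhs_eball; exact: open_nbhs_nbhs. Qed.

(** The sigma-algebra is generated by the coordinates, so a countable description is needed: an open
    set is the union of the cubes [B m], with rational centre and radius [1/(k+1)], that it
    contains. *)
Lemma open_row_measurable E : open E -> measurable E.
Proof.
move=> oE.
pose B (m : 'rV[rat]_n * nat) := [set y : 'rV[R]_n |
  forall i, `|y 0 i - ratr (m.1 0 i)| < m.2.+1%:R^-1].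
have mB m : measurable (B m).
  rewrite (_ : B m = \bigcap_(i in [set: 'I_n]) ((fun y : 'rV[R]_n => y 0 i) @^-1`
     `]ratr (m.1 0 i) - m.2.+1%:R^-1, ratr (m.1 0 i) + m.2.+1%:R^-1[)).
    apply: fin_bigcap_measurable => [|i _]; first exact: finite_finset.
    by rewrite -[X in measurable X]setTI; exact: measurable_coord.
  apply/seteqP; split => y /= H i.
    by move=> _; rewrite /= in_itv /= -ltr_distl.
  by have := H i I; rewrite /= in_itv /= -ltr_distl.
(* The second factor is everything or nothing: it selects the cubes inside [E] while the union stays
   indexed by a countable type. *)
rewrite (_ : E = \bigcup_m (B m `&` [set _ | B m `<=` E])).
  apply: countable_bigcupT_measurable => [|m]; first exact: countableP.
  have [BE|BE] := pselect (B m `<=` E).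
    by rewrite (_ : [set _ | _] = setT) ?setIT//; apply/seteqP; split.
  by rewrite (_ : [set _ | _] = set0) ?setI0//; apply/seteqP; split.
apply/seteqP; split => [x Ex|x [m _ [Bx]]]; last exact.
have /nbhs_ballP[r /= r0 rE] : nbhs x E by exact: open_nbhs_nbhs.
pose k := Num.truncn (2 / r).
have kr : 2 * k.+1%:R^-1 < r.
  rewrite ltr_pdivrMr// mulrC -ltr_pdivrMr//.
  exact: truncnS_gt.
have k0 : (0 : R) < k.+1%:R^-1 by rewrite invr_gt0.
have apx i : {q : rat | x 0 i - k.+1%:R^-1 < ratr q < x 0 i + k.+1%:R^-1}.
  apply: cid; have [|q] := @rat_in_itvoo R (x 0 i - k.+1%:R^-1) (x 0 i + k.+1%:R^-1).
    by move: k0; set w := _^-1; lra.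
  by rewrite in_itv/=; exists q.
exists (\row_i sval (apx i), k) => //; split.
  by move=> i /=; rewrite mxE distrC ltr_distl; case: (apx i).
move=> y /= By; apply: rE; rewrite -ball_normE /=.
rewrite -[ltLHS]/(mx_norm (x - y)) mx_normrE.
apply/bigmax_ltP; split=> // -[i j] _ /=; rewrite (ord1 i) !mxE.
have := By j; have := svalP (apx j); rewrite /= mxE -ltr_distl.
move: (ratr _) => w xw yw.
have := ler_distD w (x 0 j) (y 0 j); rewrite [`|x 0 j - w|]distrC (distrC w (y 0 j)).
by move: kr xw yw; set v := _^-1; lra.
Qed.

Lemma row_continuous_measurable (f : 'rV[R]_n -> R) :
  continuous f -> measurable_fun setT f.
Proof.
move=> /continuousP cf.
apply: (measurability _ (RGenOpens.measurableE R)).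
move=> _ [_ [a [b ->] <-]]; rewrite setTI; apply: open_row_measurable.
exact/cf/interval_open.
Qed.

Lemma dist_to_le E x w : E w -> dist_to E x <= enorm (x - w).
Proof.
move=> Ew; apply: ge_inf; last by exists w.
by exists 0 => _ [z _ <-]; exact: enorm_ge0.
Qed.

Lemma dist_to_ge E x (r : R) : E !=set0 -> (forall w, E w -> r <= enorm (x - w)) ->
  r <= dist_to E x.
Proof.
move=> [w Ew] H; apply: lb_le_inf; first by exists (enorm (x - w)), w.
by move=> _ [z Ez <-]; exact: H.
Qed.

Lemma dist_to_lt E x (r : R) : E !=set0 -> dist_to E x < r ->
  exists2 w, E w & enorm (x - w) < r.
Proof.
move=> [w Ew] /inf_lt[|_ [z Ez <-] zr]; last by exists z.
by exists (enorm (x - w)), w.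
Qed.

Lemma dist_to_lipschitz E x y : E !=set0 ->
  dist_to E x <= dist_to E y + enorm (x - y).
Proof.
move=> E0; rewrite -lerBlDr; apply: dist_to_ge => // w Ew.
rewrite lerBlDr addrC; apply: le_trans (dist_to_le _ Ew) _.
exact: ler_enormB.
Qed.

(* The boundary point is where the segment from [x] first leaves [E]. *)
Lemma segment_boundary E x z : open E -> E x -> ~ E z ->
  exists2 w, boundary E w & enorm (x - w) <= enorm (x - z).
Proof.
move=> oE Ex nEz.
pose f t := x + t *: (z - x).
have fB t t' : f t - f t' = (t - t') *: (z - x).
  by rewrite /f opprD addrACA subrr add0r -scalerBl.
have f0 : f 0 = x by rewrite /f scale0r addr0.
have f1 : f 1 = z by rewrite /f scale1r addrC subrK.
pose T := [set t : R | 0 <= t <= 1 /\ forall u, 0 <= u <= t -> E (f u)].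
have T0 : T 0.
  split; first by rewrite lexx ler01.
  by move=> u /le_anti <-; rewrite f0.
have hT : has_sup T by split; [exists 0|exists 1 => t [/andP[]]].
pose t0 := sup T.
have t00 : 0 <= t0 by apply: ub_le_sup => //; case: hT.
have t01 : t0 <= 1 by apply: ge_sup => [|t [/andP[]]//]; exists 0.
have lt_f u : 0 <= u < t0 -> E (f u).
  move=> /andP[u0 ut]; have [t [_ Tt] ut'] := sup_gt (proj1 hT) ut.
  by apply: Tt; rewrite u0 ltW.
have ball_f t (r : R) : 0 < r -> exists2 e : R, 0 < e &
    forall u, `|u - t| < e -> eball (f t) r (f u).
  move=> r0; have N0 : 0 < enorm (z - x) + 1 by rewrite ltr_wpDl ?enorm_ge0.
  exists (r / (enorm (z - x) + 1)); first by rewrite divr_gt0.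
  move=> u; rewrite ltr_pdivlMr// => ur; rewrite /eball /= fB enormZ.
  by apply: le_lt_trans ur; rewrite ler_wpM2l// lerDl.
have nEf : ~ E (f t0).
  move=> Ef; have [r r0 rE] := open_eball oE Ef.
  have [e e0 He] := ball_f t0 r r0.
  have t01' : t0 < 1.
    by rewrite lt_neqAle t01 andbT; apply/eqP => t1; rewrite t1 f1 in Ef.
  pose t1 := Num.min 1 (t0 + e / 2).
  have t0t1 : t0 < t1 by rewrite lt_min t01'/= ltrDl divr_gt0.
  have : T t1.
    split; first by rewrite ge_min lexx andbT (le_trans t00 (ltW t0t1)).
    move=> u /andP[u0 ut1]; have [ut|ut] := ltP u t0; first by apply: lt_f; rewrite u0.
    apply/rE/He; rewrite ger0_norm ?subr_ge0//.
    by move: ut1; rewrite le_min => /andP[_]; lra.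
  by move=> /(ub_le_sup (proj2 hT)); rewrite leNgt t0t1.
exists (f t0).
  split; last by move=> /interior_subset.
  move=> B /nbhs_eball[r r0 rB]; have [e e0 He] := ball_f t0 r r0.
  have t0p : 0 < t0.
    by rewrite lt_neqAle t00 andbT; apply/eqP => t1; rewrite -t1 f0 in nEf.
  pose u := Num.max 0 (t0 - e / 2).
  have ut : u < t0 by rewrite gt_max t0p /= gtrDl oppr_lt0 divr_gt0.
  have uu : 0 <= u by rewrite le_max lexx.
  exists (f u); split; first by apply: lt_f; rewrite uu.
  apply/rB/He; rewrite ltr0_norm ?subr_lt0// opprB.
  have : t0 - e / 2 <= u by rewrite le_max lexx orbT.
  lra.
rewrite -{1}f0 fB enormZ sub0r normrN ger0_norm// enormB.
by apply: le_trans (ler_piMl _ t01) _; rewrite ?enorm_ge0// enormB.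
Qed.

End Topology.

Section ProperOpen.
Context {R : realType} {n : nat} (D : set 'rV[R]_n).
Hypotheses (oD : open D) (D0 : D !=set0) (DT : D <> setT).
Implicit Types x y z : 'rV[R]_n.

Lemma boundary_neq0 : boundary D !=set0.
Proof.
have [x Dx] := D0.
have [z nDz] : exists z, ~ D z.
  by apply: contrapT => /forallNP H; apply/DT/seteqP; split=> // z _; exact: contrapT.
by have [w Dw _] := segment_boundary oD Dx nDz; exists w.
Qed.

Lemma delta_bd_gt0 x : D x -> 0 < delta_bd D x.
Proof.
move=> Dx; have [r r0 rD] := open_eball oD Dx.
apply: lt_le_trans r0 (dist_to_ge boundary_neq0 _) => w [_ nDw].
rewrite leNgt; apply/negP => xw; apply: nDw; move/interior_id: oD => ->.
by apply: rD; rewrite /eball /= enormB.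
Qed.

(** A point of the ball outside [D] would give a boundary point closer to [x] than [delta_bd D x],
    by [segment_boundary]. *)
Lemma eball_delta_bd x : D x -> eball x (delta_bd D x) `<=` D.
Proof.
move=> Dx z xz; apply: contrapT => nDz.
have [w bw] := segment_boundary oD Dx nDz; rewrite leNgt => /negP; apply.
by apply: lt_le_trans (dist_to_le x bw); rewrite enormB.
Qed.

Lemma delta_bd_lipschitz x y : delta_bd D x <= delta_bd D y + enorm (x - y).
Proof. exact: dist_to_lipschitz boundary_neq0. Qed.

Lemma measurable_delta_bd : measurable_fun setT (@delta_bd R n D).
Proof.
apply: row_continuous_measurable => x; apply/(@cvgrPdist_lt R R _ (nbhs x) (nbhs_filter x)) => e e0.
apply: (@filterS _ (nbhs x) _ _ _ _ (eball_nbhs x e0)) => y.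
rewrite /eball /= => xy; have := delta_bd_lipschitz x y.
have := delta_bd_lipschitz y x; rewrite [enorm (x - y)]enormB ltr_norml; lra.
Qed.

End ProperOpen.

(** * John curves *)

Section JohnCurves.
Context {R : realType} {n : nat}.
Implicit Types (x : 'rV[R]_n) (D : set 'rV[R]_n) (gamma : R -> 'rV[R]_n).

(** Appending [t'] to a partition of [[0, t]] adds the chord to its length, and the curve has length
    [t'] on [[0, t']]. So every partition of [[0, t]] has length at most [t'] minus the chord, while
    the supremum of these lengths is [t]. *)
Lemma arc_length_lipschitz gamma (l t t' : R) :
  arc_length_parametrized gamma l -> 0 <= t -> t <= t' -> t' <= l ->
  enorm (gamma t' - gamma t) <= t' - t.
Proof.
move=> [_ gl] t0; rewrite le_eqVlt => /predU1P[<-|tt'] t'l.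
  by rewrite !subrr enorm0.
suff : (t%:E <= (t' - enorm (gamma t' - gamma t))%:E)%E by rewrite lee_fin; lra.
rewrite -(gl t) ?t0 ?(le_trans (ltW tt'))//.
apply: ge_ereal_sup => _ [s st <-].
rewrite lee_fin lerBrDr.
suff H : itv_partition 0 t' (rcons s t').
  rewrite -lee_fin -(gl t') ?t'l ?(le_trans t0 (ltW tt'))//.
  apply: ereal_sup_ubound; exists (rcons s t') => //; congr EFin.
  rewrite size_rcons big_ord_recr /= nth_rcons ltnn eqxx; congr (_ + _).
    apply: eq_bigr => i _; rewrite nth_rcons ltn_ord -rcons_cons nth_rcons /= ltnS.
    rewrite ltnW// (set_nth_default t)//; congr (enorm (_ - gamma _)).
    by rewrite (set_nth_default t)//= ltnS ltnW.
  rewrite -rcons_cons nth_rcons /= ltnSn -last_nth.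
  by case: st => _ /eqP ->.
case: st => st /eqP lt; split; last by rewrite last_rcons.
by rewrite rcons_path st lt.
Qed.

Lemma unbounded_far D x (M : R) : ~ bounded_set D ->
  exists2 y, D y & M <= enorm (x - y).
Proof.
move=> ubD; apply: contrapT => /forall2NP H; apply: ubD.
exists (enorm x + M); split; first exact: num_real.
move=> N MN y Dy; apply: le_trans (ltW MN); apply: le_trans (norm_le_enorm y) _.
have [//|/negP] := H y; rewrite -ltNge => xy.
have := ler_enormD x (y - x); rewrite addrC subrK [enorm (y - x)]enormB; lra.
Qed.

(** Join [x] to a point at distance at least [2 T]. Such a curve has length at least [2 T], so up to
    time [T] the minimum in the John condition is [t] itself. *)
Lemma john_ray (c : R) D x (T : R) : john_domain c D -> 1 <= c -> ~ bounded_set D ->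
  D x -> 0 <= T ->
  exists gamma, [/\ gamma 0 = x,
    forall t, 0 <= t <= T -> D (gamma t) /\ t / c <= delta_bd D (gamma t) &
    forall t t', 0 <= t -> t <= t' -> t' <= T -> enorm (gamma t' - gamma t) <= t' - t].
Proof.
move=> [_ _ Dj] c1 ubD Dx T0; have [y Dy xy] := unbounded_far x (2 * T) ubD.
have [l [gamma [l0 [g0 gl] gal gD gd]]] := Dj _ _ Dx Dy.
have Tl : 2 * T <= l.
  apply: le_trans xy _; rewrite enormB -g0 -gl.
  by rewrite -[leRHS]subr0; exact: (arc_length_lipschitz gal).
exists gamma; split=> // [t /andP[t0 tT]|t t' t0 tt' t'T]; last first.
  by apply: (arc_length_lipschitz gal) => //; lra.
have tl : 0 <= t <= l by lra.
split; first exact: gD.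
apply: le_trans (gd _ tl); rewrite ler_wpM2r ?invr_ge0//; first lra.
by rewrite le_min lexx/=; lra.
Qed.

End JohnCurves.

(** * Boxes and averages *)

Section PowerFacts.
Context {R : realType}.

Lemma powRD_gt0 (x r s : R) : 0 < x -> x `^ (r + s) = x `^ r * x `^ s.
Proof. by move=> x0; rewrite powRD// (gt_eqF x0) implybT. Qed.

(** If [w > lam], then [w^(p-1) >= lam^(p-1)] and the second term alone is at least [w]. The bound
    is affine in [w^p], so it can be integrated with [lam] fixed; [young_optimal] chooses [lam]
    afterwards. *)
Lemma young_split (p lam w : R) : 1 <= p -> 0 < lam -> 0 <= w ->
  w <= lam + lam `^ (1 - p) * w `^ p.
Proof.
move=> p1 l0 w0; have [wl|lw] := leP w lam.
  by apply: le_trans wl _; rewrite lerDl mulr_ge0 ?powR_ge0.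
have w0' : 0 < w by apply: lt_trans lw.
apply: (@le_trans _ _ (lam `^ (1 - p) * w `^ p)); last by rewrite lerDr ltW.
have -> : lam `^ (1 - p) = (lam `^ (p - 1))^-1 by rewrite -powRN opprB.
rewrite mulrC ler_pdivlMr ?powR_gt0//.
have -> : w `^ p = w * w `^ (p - 1).
  by rewrite -{2}(powRr1 (ltW w0')) -powRD_gt0// addrC subrK.
rewrite ler_wpM2l// ge0_ler_powR ?subr_ge0// ?nnegrE; [exact: ltW..|].
exact: ltW.
Qed.

(** The choice [lam = Z^(1/p)] makes both terms equal; for [Z = 0] let [lam] tend to 0. Together
    with [young_split] this does the work of Jensen's inequality for averages, at the cost of a
    factor 2. *)
Lemma young_optimal (p Z : R) (X Y : \bar R) : 1 <= p -> 0 <= Z ->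
  (forall lam, 0 < lam -> (X <= (lam + lam `^ (1 - p) * Z)%:E + Y)%E) ->
  (X <= (2 * Z `^ p^-1)%:E + Y)%E.
Proof.
move=> p1; have p0 : 0 < p by lra.
rewrite le_eqVlt => /predU1P[<-|Z0] H.
  rewrite powR0 ?mulr0 ?add0e ?invr_neq0 ?gt_eqF//.
  apply/lee_addgt0Pr => e e0; rewrite addeC.
  by have := H e e0; rewrite mulr0 addr0.
have := H _ (powR_gt0 p^-1 Z0); rewrite -powRrM mulrBr mulr1 mulVf ?gt_eqF//.
rewrite -{3}(powRr1 (ltW Z0)) -powRD_gt0// subrK.
by rewrite mulr_natl mulr2n.
Qed.

End PowerFacts.

Section Boxes.
Context {R : realType} {n : nat}.
Implicit Types (x y z : 'rV[R]_n) (r : R) (f g : 'rV[R]_n -> \bar R).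
Local Notation mu := (lebesgue_row n : {measure set 'rV[R]_n -> \bar R}).

(* Half-open, so that [lebesgue_row_box] gives the measure. *)
Definition box y (r : R) : set 'rV[R]_n :=
  [set z | forall i, y 0 i - r < z 0 i <= y 0 i + r].

Lemma measurable_box y r : measurable (box y r).
Proof.
rewrite (_ : box y r = \bigcap_(i in [set: 'I_n])
    ((fun z : 'rV[R]_n => z 0 i) @^-1` `]y 0 i - r, y 0 i + r])).
  apply: fin_bigcap_measurable => [|i _]; first exact: finite_finset.
  by rewrite -[X in measurable X]setTI; exact: measurable_coord.
apply/seteqP; split => z /= H i; first by move=> _; have := H i; rewrite /= in_itv.
by have := H i I; rewrite /= in_itv.
Qed.

Lemma box_measure y r : 0 <= r -> mu (box y r) = ((2 * r) ^+ n)%:E.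
Proof.
move=> r0; have yr i : y 0 i - r <= y 0 i + r by lra.
apply: etrans (lebesgue_row_box yr) _.
congr EFin; rewrite -[in RHS](card_ord n) -prodr_const.
by apply: eq_bigr => i _; ring.
Qed.

Lemma box_enorm y r z : 0 <= r -> box y r z -> enorm (z - y) <= n%:R * r.
Proof.
move=> r0 H; apply: le_trans (enorm_le_sum _) _.
rewrite mulr_natl -[X in _ *+ X]card_ord -sumr_const; apply: ler_sum => i _.
by have := H i; rewrite !mxE ler_norml; lra.
Qed.

Lemma enorm_box y r z : enorm (z - y) < r -> box y r z.
Proof.
move=> zr i; have := le_lt_trans (ler_coord_enorm _ i) zr.
by rewrite !mxE ltr_norml; lra.
Qed.

Definition box_avg f y (r : R) : \bar R :=
  (((2 * r) ^- n)%:E * \int[mu]_(z in box y r) f z)%E.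

Lemma le_box_avg f g y r : 0 < r ->
  measurable_fun setT f -> measurable_fun setT g -> (forall z, 0 <= f z)%E ->
  (forall z, box y r z -> (f z <= g z)%E) -> (box_avg f y r <= box_avg g y r)%E.
Proof.
move=> r0 mf mg f0 fg; rewrite /box_avg lee_wpmul2l//.
  by rewrite lee_fin invr_ge0 exprn_ge0// mulr_ge0// ltW.
have mB := measurable_box y r.
by apply: ge0_le_integral => //; exact: measurable_funTS.
Qed.

Lemma box_avgD f g y r : 0 < r ->
  measurable_fun setT f -> measurable_fun setT g ->
  (forall z, 0 <= f z)%E -> (forall z, 0 <= g z)%E ->
  (box_avg (f \+ g) y r = box_avg f y r + box_avg g y r)%E.
Proof.
move=> r0 mf mg f0 g0; rewrite /box_avg ge0_integralD//.
- by rewrite ge0_muleDr// integral_ge0.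
- exact: measurable_box.
- exact: measurable_funTS.
- exact: measurable_funTS.
Qed.

Lemma box_avg_cst (k : \bar R) y r : 0 < r -> box_avg (cst k) y r = k.
Proof.
move=> r0; rewrite /box_avg integral_cst; last exact: measurable_box.
rewrite box_measure ?ltW// muleCA -EFinM mulVf ?mule1//.
by rewrite expf_neq0// mulf_neq0// gt_eqF.
Qed.

Lemma box_avgZ (k : R) f y r : 0 < r -> measurable_fun setT f ->
  (forall z, 0 <= f z)%E -> 0 <= k ->
  (box_avg (fun z => k%:E * f z) y r = k%:E * box_avg f y r)%E.
Proof.
move=> r0 mf f0 k0; rewrite /box_avg ge0_integralZl//; first by rewrite muleCA.
- exact: measurable_box.
- exact: measurable_funTS.
Qed.

Lemma measurable_enorm d (T : measurableType d) (f : T -> 'rV[R]_n) :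
  (forall i, measurable_fun setT (fun t => f t 0 i)) ->
  measurable_fun setT (fun t => enorm (f t)).
Proof.
move=> mf; rewrite /enorm.
apply: (measurableT_comp (continuous_measurable_fun (@sqrt_continuous R))).
by apply: measurable_sum => i; exact: measurable_funX.
Qed.

Lemma measurable_coordB d (T : measurableType d) (f g : T -> 'rV[R]_n) i :
  measurable_fun setT f -> measurable_fun setT g ->
  measurable_fun setT (fun t => (f t - g t) 0 i).
Proof.
move=> mf mg; under eq_fun do rewrite !mxE.
apply: measurable_funB;
  exact: (measurableT_comp (measurable_coord i)).
Qed.

Lemma measurable_eball x r : measurable (eball x r).
Proof.
rewrite -[X in measurable X]setTI.
rewrite (_ : eball x r = (fun y => enorm (y - x) < r) @^-1` [set true]).
  apply: (measurable_fun_ltr (f := fun y => enorm (y - x)) (g := cst r)) => //.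
  by apply: measurable_enorm => i; exact: measurable_coordB.
by apply/seteqP; split => y.
Qed.

End Boxes.

(** * Comparison of averages by the local energy *)

Section LocalEnergy.
Context {R : realType} {n : nat}.
Implicit Types (x y z a b : 'rV[R]_n) (r lam M Q : R) (D : set 'rV[R]_n).
Local Notation mu := (lebesgue_row n : {measure set 'rV[R]_n -> \bar R}).
Variables (p sigma : R) (u rho : 'rV[R]_n -> R).
Hypotheses (p1 : 1 <= p) (sigma0 : 0 < sigma).
Hypotheses (u_meas : measurable_fun setT u) (rho_meas : measurable_fun setT rho).

(** On the diagonal the numerator is 0 because [p >= 1], so the kernel is 0 there. *)
Definition kern x y : R := `|u x - u y| `^ p / enorm (x - y) `^ sigma.

Definition energy x : \bar R := (\int[mu]_(y in eball x (rho x)) (kern x y)%:E)%E.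

Lemma kern_ge0 x y : 0 <= kern x y.
Proof. by rewrite divr_ge0 ?powR_ge0. Qed.

Lemma energy_ge0 x : (0 <= energy x)%E.
Proof. by apply: integral_ge0 => y _; rewrite lee_fin kern_ge0. Qed.

Lemma measurable_kern : measurable_fun setT (fun z : 'rV[R]_n * 'rV[R]_n => kern z.1 z.2).
Proof.
apply: measurable_funM.
  apply: (measurableT_comp (measurable_powR p)).
  apply: (measurableT_comp (@normr_measurable R setT)).
  apply: measurable_funB.
    exact: (measurableT_comp u_meas measurable_fst).
  exact: (measurableT_comp u_meas measurable_snd).
rewrite (_ : (fun _ => _) = (fun z : 'rV[R]_n * 'rV[R]_n => enorm (z.1 - z.2) `^ (- sigma))).
  apply: (measurableT_comp (measurable_powR _)).
  apply: measurable_enorm => i; apply: measurable_coordB.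
    exact: measurable_fst.
  exact: measurable_snd.
by apply/funext => z; rewrite powRN.
Qed.

Lemma measurable_kern1 x : measurable_fun setT (kern x).
Proof.
have m1 : measurable_fun setT (fun y : 'rV[R]_n => (x, y)).
  by apply: measurable_fun_pair; [exact: measurable_cst|exact: measurable_id].
exact: (measurableT_comp measurable_kern m1).
Qed.

(** The ball varies with [x], so its indicator is made part of a jointly measurable integrand [F],
    whose partial integral is measurable by Tonelli. *)
Lemma measurable_energy : measurable_fun setT energy.
Proof.
pose F (z : 'rV[R]_n * 'rV[R]_n) : \bar R :=
  if enorm (z.2 - z.1) < rho z.1 then (kern z.1 z.2)%:E else 0%E.
have mF : measurable_fun setT F.
  apply: measurable_fun_ifT; last exact: measurable_cst.
    apply: measurable_fun_ltr.
      apply: measurable_enorm => i; apply: measurable_coordB.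
        exact: measurable_snd.
      exact: measurable_fst.
    exact: (measurableT_comp rho_meas measurable_fst).
  by apply/measurable_EFinP; exact: measurable_kern.
have F0 w : (0 <= F w)%E by rewrite /F; case: ifP => // _; rewrite lee_fin kern_ge0.
have := @measurable_fun_fubini_tonelli_F _ _ _ _ R (lebesgue_row n) F mF F0.
congr measurable_fun; apply/funext => x; rewrite /energy integral_mkcond.
apply: eq_integral => y _; rewrite /F /patch /=.
case: ifPn => xy; first by rewrite mem_set.
by rewrite memNset//; exact/negP.
Qed.

(** Bound [|u a|] by [|u a - u b| + |u b|], split the difference with [young_split], and average
    over [b]. As [|a - b| <= M], the factor [M^sigma / |a - b|^sigma] is at least 1 off the diagonal
    and may be inserted, which produces the kernel; the box lies in the ball of the energy. *)
Lemma abs_le_energy a y r M lam : 0 < r -> 0 < M -> 0 < lam ->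
  (forall b, box y r b -> enorm (a - b) <= M /\ eball a (rho a) b) ->
  (`|u a|%:E <= lam%:E + (lam `^ (1 - p) * ((2 * r) ^- n * M `^ sigma))%:E * energy a
    + box_avg (fun b => `|u b|%:E) y r)%E.
Proof.
move=> r0 M0 lam0 H.
have p0 : p != 0 by rewrite gt_eqF// (lt_le_trans ltr01).
have mabs : measurable_fun setT (fun b => `|u b|%:E).
  apply/measurable_EFinP.
  exact: (measurableT_comp (@normr_measurable R setT)).
pose k := lam `^ (1 - p) * M `^ sigma.
have k0 : 0 <= k by rewrite mulr_ge0 ?powR_ge0.
have mk : measurable_fun setT (EFin \o kern a).
  by apply/measurable_EFinP; exact: measurable_kern1.
have mkk : measurable_fun setT (fun b => k%:E * (EFin \o kern a) b)%E.
  by apply: emeasurable_funM => //; exact: measurable_cst.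
have ker0 b : (0 <= (EFin \o kern a) b)%E by rewrite lee_fin kern_ge0.
have kk0 b : (0 <= k%:E * (EFin \o kern a) b)%E by apply: mule_ge0; rewrite ?lee_fin// kern_ge0.
rewrite -[leLHS](box_avg_cst `|u a|%:E y r0).
apply: (@le_trans _ _ (box_avg ((cst lam%:E \+ (fun b => k%:E * (EFin \o kern a) b))
    \+ (fun b => `|u b|%:E))%E y r)).
  apply: le_box_avg => //.
  - by apply: emeasurable_funD => //; apply: emeasurable_funD.
  - by move=> b; rewrite lee_fin.
  move=> b /H[abM ab] /=; rewrite -EFinM -!EFinD lee_fin.
  apply: (@le_trans _ _ (`|u a - u b| + `|u b|)).
    by have := ler_normD (u a - u b) (u b); rewrite subrK.
  rewrite lerD2r; apply: le_trans (young_split p1 lam0 (normr_ge0 _)) _.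
  rewrite lerD2l /k -mulrA ler_wpM2l ?powR_ge0// /kern mulrCA.
  have [->|ab0] := eqVneq a b; first by rewrite subrr normr0 powR0// mul0r.
  rewrite ler_peMr ?powR_ge0// ler_pdivlMr ?powR_gt0 ?enorm_gt0 ?subr_eq0// mul1r.
  by rewrite ge0_ler_powR ?nnegrE ?enorm_ge0// ltW.
rewrite box_avgD//; last 2 first.
- by apply: emeasurable_funD.
- by move=> b; apply: adde_ge0; [rewrite lee_fin ltW|exact: kk0].
rewrite box_avgD//; last by move=> b /=; rewrite lee_fin ltW.
rewrite box_avg_cst// box_avgZ// leeD2r// leeD2l//.
rewrite /box_avg muleA -EFinM.
rewrite (_ : _ * (_ * _) = k * (2 * r) ^- n); last by rewrite /k; ring.
apply: lee_wpmul2l.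
  by rewrite lee_fin mulr_ge0// invr_ge0 exprn_ge0// mulr_ge0// ltW.
apply: ge0_subset_integral => //.
- exact: measurable_box.
- exact: measurable_eball.
- exact: measurable_funTS.
- by move=> b /H[].
Qed.

Lemma abs_le_box_avg a y r M (Q : R) : 0 < r -> 0 < M -> 0 <= Q ->
  (forall b, box y r b -> enorm (a - b) <= M /\ eball a (rho a) b) ->
  (energy a <= Q%:E)%E ->
  (`|u a|%:E <= (2 * ((2 * r) ^- n * M `^ sigma * Q) `^ p^-1)%:E
    + box_avg (fun b => `|u b|%:E) y r)%E.
Proof.
move=> r0 M0 Q0 H EQ.
have v0 : 0 <= (2 * r) ^- n by rewrite invr_ge0 exprn_ge0// mulr_ge0// ltW.
apply: young_optimal => // [|lam lam0]; first by rewrite !mulr_ge0 ?powR_ge0.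
apply: le_trans (abs_le_energy r0 M0 lam0 H) _.
rewrite leeD2r// EFinD leeD2l// (mulrA _ _ Q) [leRHS]EFinM; apply: lee_wpmul2l => //.
by rewrite lee_fin !mulr_ge0 ?powR_ge0.
Qed.

(** The pointwise bound is averaged over [a] with a common [lam] and only then optimised, because
    the integral of the energy over the first box is controlled, but not its values. *)
Lemma box_avg_le_box_avg y' r' y r M (Q : R) : 0 < r' -> 0 < r -> 0 < M -> 0 <= Q ->
  (forall a, box y' r' a ->
    forall b, box y r b -> enorm (a - b) <= M /\ eball a (rho a) b) ->
  (\int[mu]_(a in box y' r') energy a <= Q%:E)%E ->
  (box_avg (fun b => `|u b|%:E) y' r' <=
    (2 * ((2 * r) ^- n * M `^ sigma * ((2 * r') ^- n * Q)) `^ p^-1)%:E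
    + box_avg (fun b => `|u b|%:E) y r)%E.
Proof.
move=> r'0 r0 M0 Q0 H EQ.
have v0 : 0 <= (2 * r) ^- n by rewrite invr_ge0 exprn_ge0// mulr_ge0// ltW.
have v'0 : 0 <= (2 * r') ^- n by rewrite invr_ge0 exprn_ge0// mulr_ge0// ltW.
have mabs : measurable_fun setT (fun b => `|u b|%:E).
  apply/measurable_EFinP.
  exact: (measurableT_comp (@normr_measurable R setT)).
have avg0 : (0 <= box_avg (fun b => `|u b|%:E) y r)%E.
  by rewrite mule_ge0// integral_ge0.
apply: young_optimal => // [|lam lam0]; first by rewrite !mulr_ge0 ?powR_ge0.
set k := lam `^ (1 - p) * ((2 * r) ^- n * M `^ sigma).
have k0 : 0 <= k by rewrite !mulr_ge0 ?powR_ge0.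
have mkE : measurable_fun setT (fun a => k%:E * energy a)%E.
  by apply: emeasurable_funM => //; exact: measurable_energy.
have kE0 a : (0 <= k%:E * energy a)%E by rewrite mule_ge0 ?energy_ge0.
apply: (@le_trans _ _ (box_avg ((cst lam%:E \+ (fun a => k%:E * energy a))
    \+ cst (box_avg (fun b => `|u b|%:E) y r))%E y' r')).
  apply: le_box_avg => //.
  - by apply: emeasurable_funD => //; apply: emeasurable_funD.
  move=> a /H Ha; exact: (abs_le_energy r0 M0 lam0 Ha).
rewrite box_avgD//; last 2 first.
- by apply: emeasurable_funD.
- by move=> b; apply: adde_ge0; [rewrite lee_fin ltW|exact: kE0].
rewrite box_avgD//; last by move=> b /=; rewrite lee_fin ltW.
rewrite !box_avg_cst// box_avgZ//; last 2 first.
- exact: measurable_energy.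
- exact: energy_ge0.
rewrite leeD2r// EFinD leeD2l// (mulrA _ _ (_ * Q)) -/k [leRHS]EFinM.
by apply: lee_wpmul2l => //; rewrite EFinM; exact: lee_wpmul2l.
Qed.

End LocalEnergy.

(** * Integrals of powers of the distance *)

Section GeometricBounds.
Context {R : realType}.

Lemma ler_powR_base (x y r : R) : 0 <= r -> 0 <= x -> x <= y -> x `^ r <= y `^ r.
Proof.
by move=> r0 x0 xy; apply: ge0_ler_powR; rewrite // nnegrE// (le_trans x0).
Qed.

Lemma powR_gt1 (x r : R) : 1 < x -> 0 < r -> 1 < x `^ r.
Proof.
move=> x1 r0; rewrite -[X in X < _](_ : 1 `^ r = 1); last by rewrite powR1.
by apply: gt0_ltr_powR; rewrite ?nnegrE// (le_trans ler01)// ltW.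
Qed.

Lemma powRV (x r : R) : 0 <= x -> x^-1 `^ r = (x `^ r)^-1.
Proof. by move=> x0; rewrite -powR_inv1// -powRrM mulN1r powRN. Qed.

(** The upper bound on [d] serves for [e >= 0], the lower one for [e < 0]; the exponent [|e|] covers
    both. *)
Lemma powR_comparable (M d e t : R) : 0 < t -> 1 <= M -> t / M <= d -> d <= M * t ->
  d `^ e <= M `^ `|e| * t `^ e.
Proof.
move=> t0 M1 td dt; have M0 : 0 < M by exact: lt_le_trans ltr01 M1.
have d0 : 0 < d by apply: lt_le_trans td; rewrite divr_gt0.
have [e0|e0] := leP 0 e.
  rewrite ger0_norm//; apply: le_trans (ler_powR_base e0 (ltW d0) dt) _.
  by rewrite (powRM _ (ltW M0) (ltW t0)).
have e0' : 0 <= - e by rewrite oppr_ge0 ltW.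
rewrite ltr0_norm// -[in leLHS](opprK e) -[in X in _ * X](opprK e) !(powRN _ (- e)).
rewrite ler_pdivlMr ?powR_gt0// ler_pdivrMl ?powR_gt0//.
rewrite [leRHS]mulrC -(powRM _ (ltW M0) (ltW d0)).
apply: ler_powR_base => //; first exact: ltW.
by rewrite mulrC -ler_pdivrMr.
Qed.

Lemma geometric_sum_le (q : R) k : 0 <= q < 1 -> \sum_(i < k) q ^+ i <= (1 - q)^-1.
Proof.
move=> /andP[q0 q1]; have q1' : 0 < 1 - q by rewrite subr_gt0.
rewrite -[leRHS]mul1r ler_pdivlMr// mulrC -opprB mulNr -subrX1 opprB.
by rewrite gerBl exprn_ge0.
Qed.

Lemma nneseries_geometric_le (A q : R) (f : nat -> \bar R) : 0 <= A -> 0 <= q < 1 ->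
  (forall i, (0 <= f i)%E) -> (forall i, (f i <= (A * q ^+ i)%:E)%E) ->
  (\sum_(0 <= i <oo) f i <= (A * (1 - q)^-1)%:E)%E.
Proof.
move=> A0 q01 f0 fA; apply: lime_le; first by apply: is_cvg_nneseries => i _ _.
apply: nearW => k; rewrite big_mkord.
apply: (@le_trans _ _ (\sum_(i < k) (A * q ^+ i)%:E)%E); first exact: lee_sum.
by rewrite sumEFin lee_fin -mulr_sumr ler_wpM2l// geometric_sum_le.
Qed.

End GeometricBounds.

Section AssouadIntegral.
Context {R : realType} {n : nat}.
Implicit Types (x y z : 'rV[R]_n) (r t : R) (D : set 'rV[R]_n).
Local Notation mu := (lebesgue_row n : {measure set 'rV[R]_n -> \bar R}).

Lemma measure_cover_boxes (s : seq 'rV[R]_n) r (A : set 'rV[R]_n) :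
  0 <= r -> measurable A -> (forall x, A x -> exists2 z, z \in s & box z r x) ->
  (mu A <= ((size s)%:R * (2 * r) ^+ n)%:E)%E.
Proof.
move=> r0; elim: s A => [|z s IH] A mA As.
  rewrite mul0r (_ : A = set0) ?measure0//.
  by apply/seteqP; split=> // x /As[].
have mB := measurable_box z r.
rewrite (measureDI _ mA mB) /= mulrSr mulrDl mul1r EFinD; apply: leeD.
  apply: IH; first exact: measurableD.
  move=> x [/As[w]]; rewrite inE => /predU1P[->//|ws xw _]; by exists w.
rewrite -(box_measure z r0); apply: le_measure; rewrite ?inE//; exact: measurableI.
Qed.

(** Cut the set into layers on which the distance is about [rho i = t / 2^i]. The covering of the
    boundary at scale [rho i] bounds the measure of a layer by a multiple of
    [(rho i / t)^(- alpha) (rho i)^n]. The integrand is about [(rho i)^(a - n)], so the layers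
    contribute a geometric series of ratio [2^(alpha - a)]. *)
Lemma integral_delta_bd_le (alpha K a : R) : 1 <= K -> 0 <= alpha -> alpha < a ->
  exists2 C : R, 0 < C & forall D, open D -> D !=set0 -> D <> setT ->
  assouad_cover (boundary D) alpha K -> forall y t, D y -> delta_bd D y <= t ->
  (\int[mu]_(x in [set x | [/\ D x, (enorm (x - y) <= t)%R & (delta_bd D x <= t)%R]])
      (delta_bd D x `^ (a - n%:R))%:E <= (C * t `^ a)%:E)%E.
Proof.
move=> K1 al0 ala.
pose q : R := 2^-1 `^ (a - alpha).
have q01 : 0 <= q < 1.
  by rewrite powR_ge0 /= /q powRV// invf_lt1 ?powR_gt0// powR_gt1 ?subr_gt0 ?ltr1n.
(* The factors: [2^|a - n|] for the oscillation of the integrand on a layer, [K 5^alpha] for the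
   number of balls covering the boundary inside a ball of radius [5 t], and [6^n] for boxes of side
   [6 rho i]. *)
pose A0 : R := 2 `^ `|a - n%:R| * K * 5 `^ alpha * 6 ^+ n.
have A00 : 0 < A0.
  by rewrite !mulr_gt0 ?powR_gt0 ?exprn_gt0//; lra.
exists (A0 * (1 - q)^-1).
  by rewrite mulr_gt0// invr_gt0; case/andP: q01; lra.
move=> D oD D0 DT cov y t Dy dyt.
have dy0 := delta_bd_gt0 oD D0 DT Dy.
have t0 : 0 < t by exact: lt_le_trans dyt.
have md := measurable_delta_bd oD D0 DT.
pose rho i : R := t * 2^-1 ^+ i.
have rho0 i : 0 < rho i by rewrite mulr_gt0// exprn_gt0.
have rhoS i : rho i.+1 = rho i / 2 by rewrite /rho exprSr mulrA.
pose S i := [set x | [/\ D x, enorm (x - y) <= t & rho i.+1 < delta_bd D x <= rho i]].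
have mS i : measurable (S i).
  have m1 := open_row_measurable oD.
  have m2 : measurable [set x : 'rV[R]_n | enorm (x - y) <= t].
    rewrite -[X in measurable X]setTI.
    rewrite (_ : [set x | _] = (fun x => enorm (x - y) <= t) @^-1` [set true]).
      apply: (measurable_fun_ler (f := fun x => enorm (x - y)) (g := cst t)) => //.
      by apply: measurable_enorm => j; exact: measurable_coordB.
    by apply/seteqP; split => x.
  have m3 : measurable [set x : 'rV[R]_n | rho i.+1 < delta_bd D x <= rho i].
    rewrite (_ : [set x | _] = @delta_bd R n D @^-1` `]rho i.+1, rho i]).
      by rewrite -[X in measurable X]setTI; exact: md.
    by apply/seteqP; split => x; rewrite /= in_itv.
  rewrite (_ : S i = D `&` [set x : 'rV[R]_n | enorm (x - y) <= t]
     `&` [set x : 'rV[R]_n | rho i.+1 < delta_bd D x <= rho i]).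
    by apply: measurableI => //; exact: measurableI.
  by apply/seteqP; split => x /=; [case|case=> [[]]].
have mf : measurable_fun setT (fun x => (delta_bd D x `^ (a - n%:R))%:E).
  by apply/measurable_EFinP; exact: (measurableT_comp (measurable_powR _) md).
have rho_le i j : (i <= j)%N -> rho j <= rho i.
  move=> ij; rewrite /rho (ler_wpM2l (ltW t0))// ler_wiXn2l//; lra.
have -> : [set x | [/\ D x, enorm (x - y) <= t & delta_bd D x <= t]] = \bigcup_i S i.
  apply/seteqP; split => [x [Dx xy xt]|x [i _ [Dx xy /andP[_ xi]]]]; last first.
    split=> //; apply: le_trans xi _; rewrite -[leRHS]mulr1 -[X in _ * X](expr0 (2^-1)).
    exact: rho_le.
  have [i ri] : exists i, rho i.+1 < delta_bd D x.
    have dxt : 0 < delta_bd D x / t by rewrite divr_gt0// (delta_bd_gt0 oD D0 DT Dx).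
    have h1 : `|2^-1 : R| < 1 by rewrite ger0_norm; lra.
    have /cvgrPdist_lt /(_ _ dxt)[i _ /(_ i.+1 (leqnSn i))] := cvg_expr h1.
    rewrite sub0r normrN ger0_norm ?exprn_ge0// ltr_pdivlMr// mulrC => H.
    by exists i.
  (* The least such index [k] also gives [delta_bd D x <= rho k]: by minimality, or by
     [delta_bd D x <= t] when [k = 0]. *)
  case: (ex_minnP (ex_intro (fun i => rho i.+1 < delta_bd D x) _ ri)) => k rk kmin.
  exists k => //; split=> //; rewrite rk /=.
  case: k rk kmin => [|k] _ kmin; first by rewrite /rho expr0 mulr1.
  by rewrite leNgt; apply/negP => /kmin; rewrite ltnn.
rewrite ge0_integral_bigcup//; last 3 first.
- exact: measurable_funTS.
- by move=> x _; rewrite lee_fin powR_ge0.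
- apply/trivIsetP => /= i j _ _; wlog ij : i j / (i < j)%N.
    move=> H; rewrite neq_ltn => /orP[ij|ji]; first by apply: H; rewrite // neq_ltn ij.
    by rewrite setIC; apply: H; rewrite // neq_ltn ji.
  move=> _; apply/seteqP; split => // x [[_ _ /andP[ix _]] [_ _ /andP[_ xj]]].
  by have := lt_le_trans ix (le_trans xj (rho_le _ _ ij)); rewrite ltxx.
rewrite -mulrA mulrCA mulrC.
rewrite (_ : _ * _ = A0 * t `^ a * (1 - q)^-1); last by ring.
apply: nneseries_geometric_le => // [|i|i].
- by rewrite mulr_ge0 ?powR_ge0// ltW.
- by apply: integral_ge0 => x _; rewrite lee_fin powR_ge0.
(* Boundary points near a layer lie within [2 t + t + 2 t] of [w], hence the radius [5 t]. A point
   of the layer is within [2 rho i + rho i] of a centre of the cover, hence boxes of half-side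
   [3 rho i]. *)
have [w bw yw] : exists2 w, boundary D w & enorm (y - w) < 2 * t.
  by apply: dist_to_lt; [exact: boundary_neq0|rewrite -/(delta_bd D y); lra].
have rit : rho i < 5 * t.
  by apply: (@le_lt_trans _ _ (rho 0%N)); [exact: rho_le|rewrite /rho expr0; lra].
have [s ss sc] := cov w (rho i) (5 * t) bw (rho0 i) rit.
have muS : (mu (S i) <= (K * (rho i / (5 * t)) `^ (- alpha) * (6 * rho i) ^+ n)%:E)%E.
  apply: (@le_trans _ _ ((size s)%:R * (2 * (3 * rho i)) ^+ n)%:E).
    apply: measure_cover_boxes => //; first by have := rho0 i; lra.
    move=> x [Dx xy /andP[_ xi]].
    have [v bv xv] : exists2 v, boundary D v & enorm (x - v) < 2 * rho i.
      apply: dist_to_lt; first exact: boundary_neq0.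
      by rewrite -/(delta_bd D x); have := rho0 i; lra.
    have [||z zs vz] := sc v; first exact: bv.
      rewrite /eball /=; have := ler_enormB v w x; have := ler_enormB x w y.
      by have := rho_le 0%N i isT; rewrite /rho expr0 [enorm (v - x)]enormB -/(rho i); lra.
    exists z => //; apply: enorm_box; have := ler_enormB x z v.
    by move: vz; rewrite /eball /=; lra.
  rewrite (_ : 2 * (3 * rho i) = 6 * rho i); last by ring.
  by rewrite lee_fin ler_wpM2r// exprn_ge0// mulr_ge0// ltW.
apply: (@le_trans _ _ (\int[mu]_(x in S i) (cst (2 `^ `|a - n%:R| * rho i `^ (a - n%:R))%:E x))%E).
  apply: ge0_le_integral => //.
  - by move=> x _; rewrite lee_fin powR_ge0.
  - exact: measurable_funTS.
  - move=> x [_ _ /andP[ix xi]]; rewrite lee_fin powR_comparable//; first by lra.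
      by rewrite -rhoS ltW.
    by apply: le_trans xi _; have := rho0 i; lra.
rewrite integral_cst//.
apply: (@le_trans _ _ ((2 `^ `|a - n%:R| * rho i `^ (a - n%:R))%:E *
  (K * (rho i / (5 * t)) `^ (- alpha) * (6 * rho i) ^+ n)%:E)%E).
  by apply: lee_wpmul2l muS; rewrite lee_fin mulr_ge0 ?powR_ge0.
rewrite -EFinM lee_fin.
have w0 : 0 < (2^-1 : R) ^+ i by rewrite exprn_gt0.
rewrite /A0 exprMn.
have -> : q ^+ i = ((2^-1 : R) ^+ i) `^ (a - alpha).
  by rewrite /q -powR_mulrn ?powR_ge0// -powRrM mulrC powRrM powR_mulrn.
have -> : rho i `^ (a - n%:R) = t `^ a * (2^-1 ^+ i) `^ a * (rho i ^+ n)^-1.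
  rewrite powRD_gt0// powRN powR_mulrn ?ltW//; congr (_ / _).
  by rewrite /rho powRM ?ltW.
have -> : rho i / (5 * t) = 5^-1 * 2^-1 ^+ i by rewrite /rho; field; rewrite gt_eqF.
rewrite (powRM _ _ (ltW w0)) ?invr_ge0// (powRD_gt0 a _ w0).
have -> : (5^-1 : R) `^ (- alpha) = 5 `^ alpha by rewrite powRV// powRN invrK.
rewrite le_eqVlt; apply/orP; left; apply/eqP; field.
by rewrite expf_neq0// gt_eqF.
Qed.

End AssouadIntegral.

(** * Estimate inside a Whitney box *)

Lemma powR_expR {R : realType} (x r : R) : 0 < x -> x `^ r = expR (r * ln x).
Proof. by move=> x0; rewrite /powR gt_eqF. Qed.

Section WeightedIntegrals.
Context {R : realType} {n : nat} (D : set 'rV[R]_n).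
Hypotheses (oD : open D) (D0 : D !=set0) (DT : D <> setT).
Local Notation mu := (lebesgue_row n : {measure set 'rV[R]_n -> \bar R}).
Local Notation delta := (@delta_bd R n D).

Lemma measurable_delta_bd_powR (e : R) :
  measurable_fun setT (fun z : 'rV[R]_n => (delta z `^ e)%:E).
Proof.
apply/measurable_EFinP; apply: (measurableT_comp (measurable_powR _)).
exact: measurable_delta_bd.
Qed.

(** Write [f] as [f delta^(- e)] times [delta^e] and bound the last factor by [powR_comparable]. *)
Lemma integral_weight_le (B : set 'rV[R]_n) (f : 'rV[R]_n -> \bar R) (M t e : R) :
  measurable B -> measurable_fun setT f -> (forall z, 0 <= f z)%E ->
  0 < t -> 1 <= M -> (forall z, B z -> t / M <= delta z <= M * t) ->
  (\int[mu]_(z in B) f z <= (M `^ `|e| * t `^ e)%:E *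
    \int[mu]_(z in B) (f z * (delta z `^ (- e))%:E))%E.
Proof.
move=> mB mf f0 t0 M1 Bt; have mw := measurable_delta_bd_powR (- e).
have mfw : measurable_fun setT (fun z => f z * (delta z `^ (- e))%:E)%E.
  exact: emeasurable_funM.
have fw0 z : (0 <= f z * (delta z `^ (- e))%:E)%E by rewrite mule_ge0// lee_fin powR_ge0.
have c0 : 0 <= M `^ `|e| * t `^ e by rewrite mulr_ge0 ?powR_ge0.
rewrite -ge0_integralZl//; last exact: measurable_funTS.
apply: ge0_le_integral => //.
- exact: measurable_funTS.
- apply: emeasurable_funM => //; exact: measurable_funTS.
move=> z /Bt/andP[tz zt]; rewrite muleCA -EFinM.
have dz0 : 0 < delta z by apply: lt_le_trans tz; rewrite divr_gt0// (lt_le_trans ltr01).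
rewrite -[leLHS]mule1; apply: lee_wpmul2l => //.
rewrite lee_fin powRN ler_pdivlMr ?powR_gt0// mul1r.
exact: powR_comparable.
Qed.

End WeightedIntegrals.

Section LocalEstimate.
Context {R : realType} {n : nat}.
Local Notation mu := (lebesgue_row n : {measure set 'rV[R]_n -> \bar R}).
Variables (s p q beta tau kappa : R).
Hypotheses (n0 : (0 < n)%N) (s0 : 0 < s) (p1 : 1 <= p) (pq : p <= q)
  (spn : s * p < n%:R) (qps : q <= n%:R * p / (n%:R - s * p))
  (tau0 : 0 < tau < 1) (kappa0 : 0 < kappa) (kappat : n%:R * kappa <= tau / 24).
Let sigma : R := n%:R + s * p.
Let dw : R := q / p * (n%:R - s * p + beta).

Let p0 : 0 < p. Proof. exact: lt_le_trans ltr01 p1. Qed.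

(* After taking logarithms the inequality is a nonnegative combination of the
   hypotheses [r <= d] and [r^n e d^beta <= L]; the coefficient of the former is
   nonnegative precisely because [q <= n p / (n - s p)]. *)
Lemma scale_interpolation (r d e L : R) : 0 < r -> r <= d -> 0 <= e -> 0 < L ->
  r ^+ n * (e * d `^ beta) <= L ->
  r `^ s * e `^ p^-1 <= (L `^ (q / p - 1) * e * d `^ (beta + n%:R - dw)) `^ q^-1.
Proof.
move=> r0 rd; have d0 : 0 < d := lt_le_trans r0 rd.
have q0 : 0 < q := lt_le_trans p0 pq.
rewrite le_eqVlt => /predU1P[<-|e0] L0 eL.
  by rewrite powR0 ?mulr0 ?powR_ge0// invr_neq0// gt_eqF.
have qp0 : 0 <= q / p - 1 by rewrite subr_ge0 ler_pdivlMr// mul1r.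
have k0 : 0 <= s * q - n%:R * (q / p - 1).
  have h : q * (n%:R - s * p) <= n%:R * p by rewrite -ler_pdivlMr ?subr_gt0.
  rewrite (_ : _ - _ = (n%:R * p - q * (n%:R - s * p)) / p); last by field; rewrite gt_eqF.
  by rewrite divr_ge0 ?(ltW p0)// subr_ge0.
have eL' : 0 <= ln L - (n%:R * ln r + (ln e + beta * ln d)).
  rewrite subr_ge0 -ler_expR (lnK L0) !expRD -!powR_expR// (powR_mulrn _ (ltW r0)).
  by rewrite (lnK e0).
have rd' : 0 <= ln d - ln r by rewrite subr_ge0 ler_ln.
rewrite !(powR_expR _ r0, powR_expR _ d0, powR_expR _ e0, powR_expR _ L0).
rewrite -{2}[e](lnK e0) -!expRD powR_expR ?expR_gt0// expRK ler_expR.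
rewrite -subr_ge0 (_ : _ - _ = ((q / p - 1) * (ln L - (n%:R * ln r + (ln e + beta * ln d)))
  + (s * q - n%:R * (q / p - 1)) * (ln d - ln r)) / q).
  by rewrite divr_ge0 ?(ltW q0)// addr_ge0// mulr_ge0.
by rewrite /dw; field; rewrite !gt_eqF.
Qed.

Let A : R := 2 ^- n * (2 * n%:R) `^ sigma.
Let C1 : R := 2 * A `^ p^-1.

Let n0R : 0 < n%:R :> R. Proof. by rewrite ltr0n. Qed.

Let A0 : 0 < A.
Proof. by rewrite mulr_gt0 ?invr_gt0 ?exprn_gt0// powR_gt0// mulr_gt0. Qed.

Let C10 : 0 < C1. Proof. by rewrite mulr_gt0 ?powR_gt0. Qed.

Let sigma0 : 0 < sigma. Proof. by rewrite addr_gt0// mulr_gt0. Qed.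

Let A_scale (r : R) : 0 < r -> (2 * r) ^- n * (2 * n%:R * r) `^ sigma = A * r `^ (s * p).
Proof.
move=> r0; rewrite exprMn invfM powRM ?mulr_ge0// ?(ltW r0)// /A.
have -> : r `^ (s * p) = (r ^+ n)^-1 * r `^ sigma.
  rewrite -(powR_mulrn n (ltW r0)) -powRN -powRD_gt0//.
  by congr (_ `^ _); rewrite /sigma; ring.
by rewrite mulrACA !mulrA.
Qed.

Let nu : R := n%:R / p - s.

Let nu0 : 0 < nu. Proof. by rewrite subr_gt0 ltr_pdivlMr. Qed.

Let two_nu : 1 < 2 `^ nu :> R.
Proof. by apply: powR_gt1; rewrite ?ltr1n. Qed.

(** Solves [C1 + C2 = 2^nu C2], which closes the induction in [avg_chain]. *)
Let C2 : R := C1 / (2 `^ nu - 1).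

Let C20 : 0 < C2. Proof. by rewrite divr_gt0// subr_gt0. Qed.

Let C3 : R := C1 + C2 * (2 `^ `|beta| * 2 ^+ n) `^ p^-1.

Let C30 : 0 < C3.
Proof. by rewrite addr_gt0// mulr_gt0 ?powR_gt0// mulr_gt0 ?powR_gt0 ?exprn_gt0. Qed.

Section FixedDomain.
Variables (D : set 'rV[R]_n) (u : 'rV[R]_n -> R).
Hypotheses (oD : open D) (D0 : D !=set0) (DT : D <> setT).
Hypothesis (u_meas : measurable_fun setT u).
Local Notation delta := (@delta_bd R n D).
Local Notation rho := (fun z => tau * delta z).
Local Notation G := (energy p sigma u rho).
Local Notation avg := (box_avg (fun b => `|u b|%:E)).
Implicit Types (x y z a b : 'rV[R]_n) (r : R).

Let kappa1 : n%:R * kappa <= 24^-1.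
Proof. by case/andP: tau0 => _ t1; apply: le_trans kappat _; lra. Qed.

Let rho_meas : measurable_fun setT rho.
Proof.
by apply: measurable_funM => //; exact: measurable_delta_bd.
Qed.

(** The box has Euclidean radius at most [n r <= delta(x) / 24], and the distance to the boundary is
    1-Lipschitz. *)
Lemma box_delta_bd x a r : D x -> 0 <= r -> r <= kappa * delta x -> box x r a ->
  [/\ D a, 23 / 24 * delta x <= delta a & delta a <= 25 / 24 * delta x].
Proof.
move=> Dx r0 rx xa; have dx0 := delta_bd_gt0 oD D0 DT Dx.
have ax := box_enorm r0 xa.
have nr : n%:R * r <= 24^-1 * delta x.
  apply: (@le_trans _ _ (n%:R * (kappa * delta x))); first by rewrite ler_wpM2l.
  by rewrite mulrA ler_wpM2r// ltW.
have := delta_bd_lipschitz oD D0 DT x a; have := delta_bd_lipschitz oD D0 DT a x.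
rewrite [enorm (x - a)]enormB; split; try lra.
apply: (eball_delta_bd oD Dx); rewrite /eball /=; lra.
Qed.

(** The points are at most [tau delta(x) / 12] apart, while the ball around [a] has radius at least
    [(23/24) tau delta(x)]. *)
Lemma box_pair x a b r r' : D x -> 0 <= r <= kappa * delta x ->
  0 <= r' <= kappa * delta x -> box x r' a -> box x r b ->
  enorm (a - b) <= n%:R * (r + r') /\ eball a (rho a) b.
Proof.
move=> Dx /andP[r0 rx] /andP[r'0 r'x] xa xb.
have dx0 := delta_bd_gt0 oD D0 DT Dx.
have [_ da _] := box_delta_bd Dx r'0 r'x xa.
have ab : enorm (a - b) <= n%:R * (r + r').
  have := ler_enormB a b x; rewrite mulrDr [enorm (x - b)]enormB.
  by have := box_enorm r0 xb; have := box_enorm r'0 xa; lra.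
split=> //; rewrite /eball /= enormB; apply: le_lt_trans ab _.
have : n%:R * (r + r') <= n%:R * (2 * (kappa * delta x)) by rewrite ler_wpM2l//; lra.
have : n%:R * kappa * delta x <= tau / 24 * delta x by rewrite ler_wpM2r// ltW.
have [t0 _] := andP tau0.
have : tau * (23 / 24 * delta x) <= tau * delta a by rewrite ler_wpM2l// ltW.
have : 0 < tau * delta x by rewrite mulr_gt0.
lra.
Qed.

Lemma abs_le_avg x (e r : R) : D x -> 0 < r -> r <= kappa * delta x -> 0 <= e ->
  (G x <= e%:E)%E ->
  (`|u x|%:E <= (C1 * (r `^ s * e `^ p^-1))%:E + avg x r)%E.
Proof.
move=> Dx r0 rx e0 ex.
have dx0 := delta_bd_gt0 oD D0 DT Dx.
have H b : box x r b -> enorm (x - b) <= 2 * n%:R * r /\ eball x (rho x) b.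
  move=> xb; have xx : box x r x by move=> i; lra.
  have rr : 0 <= r <= kappa * delta x by rewrite ltW.
  have [ab ?] := box_pair Dx rr rr xx xb; split=> //.
  by apply: le_trans ab _; lra.
have M0 : 0 < 2 * n%:R * r by rewrite !mulr_gt0.
have := abs_le_box_avg p1 sigma0 u_meas r0 M0 e0 H ex.
rewrite A_scale// (powRM _ (mulr_ge0 (ltW A0) (powR_ge0 _ _)) e0).
by rewrite (powRM _ (ltW A0) (powR_ge0 _ _)) -powRrM mulfK ?gt_eqF// /C1 !mulrA.
Qed.

Lemma avg_le_avg x (Q r : R) : D x -> 0 < r -> r <= kappa * delta x -> 0 <= Q ->
  (\int[mu]_(z in box x (kappa * delta x)) G z <= Q%:E)%E ->
  (avg x (r / 2) <= (C1 * (r `^ (s - n%:R / p) * Q `^ p^-1))%:E + avg x r)%E.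
Proof.
move=> Dx r0 rx Q0 ex.
have dx0 := delta_bd_gt0 oD D0 DT Dx.
have r20 : 0 < r / 2 by lra.
have H a : box x (r / 2) a -> forall b, box x r b ->
    enorm (a - b) <= 2 * n%:R * r /\ eball a (rho a) b.
  have rr : 0 <= r <= kappa * delta x by rewrite ltW.
  have rr2 : 0 <= r / 2 <= kappa * delta x by lra.
  move=> xa b xb; have [ab ?] := box_pair Dx rr rr2 xa xb; split=> //.
  apply: le_trans ab _; rewrite (mulrC 2) -mulrA ler_wpM2l//; lra.
have M0 : 0 < 2 * n%:R * r by rewrite !mulr_gt0.
have EQ : (\int[mu]_(z in box x (r / 2)) G z <= Q%:E)%E.
  apply: le_trans ex; apply: ge0_subset_integral.
  - exact: measurable_box.
  - exact: measurable_box.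
  - by apply: measurable_funTS; exact: measurable_energy.
  - by move=> z _; exact: energy_ge0.
  - by move=> z xz i; have := xz i; lra.
have := box_avg_le_box_avg p1 sigma0 u_meas rho_meas r20 r0 M0 Q0 H EQ.
have -> : (2 * r) ^- n * (2 * n%:R * r) `^ sigma * ((2 * (r / 2)) ^- n * Q) =
    A * r `^ (s * p - n%:R) * Q.
  rewrite A_scale// (_ : 2 * (r / 2) = r); last by field.
  by rewrite powRD_gt0// powRN powR_mulrn ?(ltW r0)// !mulrA.
rewrite (powRM _ (mulr_ge0 (ltW A0) (powR_ge0 _ _)) Q0).
rewrite (powRM _ (ltW A0) (powR_ge0 _ _)) -powRrM mulrBl mulfK ?gt_eqF//.
by rewrite /C1 !mulrA.
Qed.

(** Each doubling of the scale [r] costs a multiple of [r^(- nu)] with [nu > 0], so the sum is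
    dominated by the smallest scale. *)
Lemma avg_chain x (Q : R) j : D x -> 0 <= Q ->
  (\int[mu]_(z in box x (kappa * delta x)) G z <= Q%:E)%E ->
  (avg x (kappa * delta x * 2^-1 ^+ j) <=
    (C2 * ((kappa * delta x * 2^-1 ^+ j) `^ (- nu) * Q `^ p^-1))%:E
    + avg x (kappa * delta x))%E.
Proof.
move=> Dx Q0 ex; have dx0 := delta_bd_gt0 oD D0 DT Dx.
have r00 : 0 < kappa * delta x by rewrite mulr_gt0.
elim: j => [|j IH].
  by rewrite expr0 mulr1 leeDr// lee_fin (mulr_ge0 (ltW C20))// mulr_ge0 ?powR_ge0.
rewrite exprSr [kappa * _ * (_ / _)]mulrA.
set r := kappa * delta x * 2^-1 ^+ j in IH *.
have r0 : 0 < r by rewrite mulr_gt0// exprn_gt0.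
have rx : r <= kappa * delta x.
  by rewrite ler_piMr ?(ltW r00)// exprn_ile1//; lra.
have := avg_le_avg Dx r0 rx Q0 ex.
rewrite (_ : s - n%:R / p = - nu); last by rewrite /nu opprB.
move=> /le_trans; apply; apply: le_trans (leeD2l _ IH) _.
rewrite addeA -EFinD leeD2r// lee_fin.
rewrite [X in _ <= C2 * (X * _)]powRM ?(ltW r0) ?invr_ge0// powRV// (powRN 2) invrK.
rewrite /C2 le_eqVlt; apply/orP; left; apply/eqP; field.
by rewrite gt_eqF// subr_gt0.
Qed.

(** With [r j = kappa delta(x) / 2^j], take the first [j] such that [(r j)^n e delta(x)^beta <= L].
    Passing from [u x] to the average at scale [r j] is then controlled by [scale_interpolation].
    For [j > 0], minimality shows that [L] is at most [2^n] times the left side, so the chain of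
    averages back to scale [kappa delta(x)] costs at most a multiple of the same bound. *)
Lemma local_estimate_fixed x (e L : R) : D x -> 0 <= e -> (G x <= e%:E)%E -> 0 < L ->
  (\int[mu]_(z in D) (G z * (delta z `^ beta)%:E) <= L%:E)%E ->
  (`|u x|%:E <= (C3 * (L `^ (q / p - 1) * e * delta x `^ (beta + n%:R - dw)) `^ q^-1)%:E
    + avg x (kappa * delta x))%E.
Proof.
move=> Dx e0 ex L0 GL; have dx0 := delta_bd_gt0 oD D0 DT Dx.
have mG : measurable_fun setT G by exact: measurable_energy.
have kd0 : 0 < kappa * delta x by rewrite mulr_gt0.
have kd1 : kappa * delta x <= delta x.
  rewrite ler_piMl ?(ltW dx0)//.
  apply: le_trans (_ : n%:R * kappa <= 1); first by rewrite ler_peMl ?(ltW kappa0)// ler1n.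
  by apply: le_trans kappa1 _; lra.
pose Q := 2 `^ `|beta| * delta x `^ (- beta) * L.
have Q0 : 0 <= Q by rewrite !mulr_ge0 ?powR_ge0// ltW.
have GQ : (\int[mu]_(z in box x (kappa * delta x)) G z <= Q%:E)%E.
  apply: le_trans (@integral_weight_le _ _ D oD D0 DT _ G 2 (delta x) (- beta)
    (measurable_box _ _) mG _ dx0 _ _) _.
  - exact: energy_ge0.
  - by rewrite ler1n.
  - move=> z xz; have [_ ? ?] := box_delta_bd Dx (ltW kd0) (lexx _) xz; lra.
  rewrite opprK normrN /Q [leRHS]EFinM; apply: lee_wpmul2l.
    by rewrite lee_fin mulr_ge0 ?powR_ge0.
  apply: le_trans GL; apply: ge0_subset_integral => //.
  - exact: measurable_box.
  - exact: open_row_measurable.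
  - apply: emeasurable_funM; apply: measurable_funTS => //.
    exact: measurable_delta_bd_powR.
  - by move=> z _; rewrite mule_ge0 ?energy_ge0// lee_fin powR_ge0.
  - by move=> z xz; have [] := box_delta_bd Dx (ltW kd0) (lexx _) xz.
pose r j := kappa * delta x * 2^-1 ^+ j.
have r0 j : 0 < r j by rewrite mulr_gt0// exprn_gt0.
have rk j : r j <= kappa * delta x.
  by rewrite ler_piMr ?(ltW kd0)// exprn_ile1//; lra.
set E := e * delta x `^ beta.
have E0 : 0 <= E by rewrite mulr_ge0 ?powR_ge0.
have exJ : exists j, r j ^+ n * E <= L.
  have h1 : `|2^-1 : R| < 1 by rewrite ger0_norm; lra.
  (* The [+ 1] avoids a division by 0 when [e = 0]. *)
  have h2 : 0 < L / ((kappa * delta x) ^+ n * E + 1).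
    by rewrite divr_gt0// ltr_wpDl// mulr_ge0// exprn_ge0// ltW.
  have /cvgrPdist_lt /(_ _ h2)[j _ /(_ j (leqnn j))] := cvg_expr h1.
  rewrite sub0r normrN ger0_norm ?exprn_ge0// ltr_pdivlMr; last first.
    by rewrite ltr_wpDl// mulr_ge0// exprn_ge0// ltW.
  move=> H; exists j; apply: le_trans (ltW H).
  rewrite /r exprMn mulrAC mulrC; apply: ler_pM; rewrite ?exprn_ge0//.
  - by rewrite mulr_ge0// exprn_ge0// ltW.
  - by rewrite -exprM; apply: ler_wiXn2l; rewrite ?leq_pmulr//; lra.
  - by rewrite lerDl.
set W := (L `^ _ * e * _) `^ q^-1.
have W0 : 0 <= W by exact: powR_ge0.
have Wr j : r j ^+ n * E <= L -> r j `^ s * e `^ p^-1 <= W.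
  by move=> H; apply: scale_interpolation => //; apply: le_trans (rk j) kd1.
have C3' : 0 <= C2 * (2 `^ `|beta| * 2 ^+ n) `^ p^-1.
  by rewrite mulr_ge0 ?powR_ge0// ltW.
case: (ex_minnP exJ) => -[|j] rJ Jmin.
  apply: le_trans (abs_le_avg Dx (r0 0%N) (rk 0%N) e0 ex) _.
  rewrite /r expr0 mulr1; apply: leeD2r; rewrite lee_fin.
  have WJ : (kappa * delta x) `^ s * e `^ p^-1 <= W.
    by have := Wr _ rJ; rewrite /r expr0 mulr1.
  apply: le_trans (ler_wpM2l (ltW C10) WJ) _.
  by rewrite ler_wpM2r// lerDl.
apply: le_trans (abs_le_avg Dx (r0 j.+1) (rk j.+1) e0 ex) _.
apply: le_trans (leeD2l _ (avg_chain j.+1 Dx Q0 GQ)) _.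
rewrite addeA -EFinD leeD2r// lee_fin /C3 mulrDl.
apply: lerD; first by apply: (ler_wpM2l (ltW C10)); exact: Wr.
rewrite -[leRHS]mulrA; apply: (ler_wpM2l (ltW C20)).
have LJ : L <= 2 ^+ n * r j.+1 ^+ n * E.
  have : ~~ (r j ^+ n * E <= L) by apply/negP => /Jmin; rewrite ltnn.
  rewrite -ltNge => /ltW /le_trans; apply.
  by rewrite -exprMn (_ : 2 * r j.+1 = r j)// /r exprSr; field.
apply: (@le_trans _ _ (r j.+1 `^ (- nu) * ((2 `^ `|beta| * 2 ^+ n) * (r j.+1 ^+ n * e)) `^ p^-1)).
  rewrite ler_wpM2l ?powR_ge0//; apply: ler_powR_base => //.
    by rewrite invr_ge0 ltW.
  apply: le_trans (ler_wpM2l _ LJ) _; first by rewrite mulr_ge0 ?powR_ge0.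
  rewrite /E powRN le_eqVlt; apply/orP; left; apply/eqP; field.
  by rewrite gt_eqF// powR_gt0.
have b0 : 0 <= 2 `^ `|beta| * 2 ^+ n :> R by rewrite mulr_ge0 ?powR_ge0.
have rn0 : 0 <= r j.+1 ^+ n by rewrite exprn_ge0// ltW.
rewrite (powRM _ b0 (mulr_ge0 rn0 e0)) (powRM _ rn0 e0) mulrCA.
apply: (ler_wpM2l (powR_ge0 _ _)).
rewrite mulrA -(powR_mulrn _ (ltW (r0 _))) -powRrM -(powRD_gt0 _ _ (r0 _)).
rewrite (_ : - nu + _ = s); last by rewrite /nu; ring.
exact: Wr.
Qed.

End FixedDomain.

Lemma local_estimate : exists2 C : R, 0 < C &
  forall (D : set 'rV[R]_n) (u : 'rV[R]_n -> R) x (e L : R),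
  open D -> D <> setT -> measurable_fun setT u -> D x ->
  0 <= e -> (energy p sigma u (fun z => (tau * delta_bd D z)%R) x <= e%:E)%E -> 0 < L ->
  (\int[mu]_(z in D) (energy p sigma u (fun z => (tau * delta_bd D z)%R) z *
      (delta_bd D z `^ beta)%:E) <= L%:E)%E ->
  (`|u x|%:E <=
     (C * (L `^ (q / p - 1) * e * delta_bd D x `^ (beta + n%:R - dw)) `^ q^-1)%:E
     + box_avg (fun b => `|u b|%:E) x (kappa * delta_bd D x))%E.
Proof.
exists C3 => // D u x e L oD DT u_meas Dx.
by apply: local_estimate_fixed => //; exists x.
Qed.

End LocalEstimate.

(** * Estimate along a John curve *)

(** Bound the two factors of [v^(1 - theta) v^theta] separately. *)
Lemma interpolation_le {R : realType} (v L K theta : R) : 0 <= v -> v <= L -> v <= K ->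
  0 <= theta <= 1 -> v <= L `^ (1 - theta) * K `^ theta.
Proof.
rewrite le_eqVlt => /predU1P[<-|v0] vL vK /andP[t0 t1].
  by rewrite mulr_ge0 ?powR_ge0.
rewrite -[leLHS](powRr1 (ltW v0)) -[X in v `^ X](subrK theta) powRD_gt0//.
apply: ler_pM; rewrite ?powR_ge0//; apply: ler_powR_base; rewrite ?subr_ge0 ?(ltW v0)//.
Qed.

(** Split at height [eta]: [|u| <= eta + eta^(1 - r) |u|^r]. The average of the second term is at
    most [eta^(1 - r) B / (2 t)^n], hence at most [eta] for large [t]. This is how the L^r bound
    makes averages over large boxes negligible. *)
Lemma box_avg_tail {R : realType} {n : nat} (u : 'rV[R]_n -> R) (r B eta : R) :
  (0 < n)%N -> measurable_fun setT u -> 1 <= r -> 0 < eta ->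
  (\int[lebesgue_row n]_x (`|u x| `^ r)%:E <= B%:E)%E ->
  exists2 t0 : R, 0 < t0 & forall y t, t0 <= t ->
    (box_avg (fun b => `|u b|%:E) y t <= (2 * eta)%:E)%E.
Proof.
move=> n0 u_meas r1 eta0 uB.
have B0 : 0 <= B.
  by rewrite -lee_fin; apply: le_trans uB; apply: integral_ge0 => x _; rewrite lee_fin powR_ge0.
have k0 : 0 <= eta `^ (1 - r) by exact: powR_ge0.
have q0 : 0 <= eta `^ (1 - r) * B / eta by rewrite divr_ge0 ?mulr_ge0// ltW.
exists (eta `^ (1 - r) * B / eta + 1); first by lra.
move=> y t tt; have t0 : 0 < t by lra.
have mabs : measurable_fun setT (fun b => `|u b|).
  exact: (measurableT_comp (@normr_measurable R setT)).
have mr : measurable_fun setT (fun b => (`|u b| `^ r)%:E).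
  by apply/measurable_EFinP; exact: (measurableT_comp (measurable_powR r)).
have mkr : measurable_fun setT (fun b => (eta `^ (1 - r))%:E * (`|u b| `^ r)%:E)%E.
  exact: emeasurable_funM.
apply: (@le_trans _ _ (box_avg
    (cst eta%:E \+ (fun b => (eta `^ (1 - r))%:E * (`|u b| `^ r)%:E))%E y t)).
  apply: le_box_avg => //.
  - exact/measurable_EFinP.
  - exact: emeasurable_funD.
  - by move=> z _; rewrite /= -EFinM -EFinD lee_fin young_split.
rewrite box_avgD//; last 2 first.
- by move=> z; rewrite lee_fin ltW.
- by move=> z; rewrite mule_ge0 ?lee_fin ?powR_ge0.
rewrite box_avg_cst// box_avgZ//.
have : (box_avg (fun b => (`|u b| `^ r)%:E) y t <= ((2 * t) ^- n * B)%:E)%E.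
  rewrite /box_avg EFinM; apply: lee_wpmul2l.
    by rewrite lee_fin invr_ge0 exprn_ge0// mulr_ge0// ltW.
  by apply: le_trans uB; apply: ge0_subset_integral => //; exact: measurable_box.
have k0' : (0 <= (eta `^ (1 - r))%:E)%E by rewrite lee_fin.
move=> avgB; apply: le_trans (leeD2l _ (lee_wpmul2l k0' avgB)) _.
rewrite -EFinM -EFinD lee_fin.
suff : eta `^ (1 - r) * ((2 * t) ^- n * B) <= eta by lra.
have tn : t <= (2 * t) ^+ n.
  apply: (@le_trans _ _ ((2 * t) ^+ 1)); first by rewrite expr1; lra.
  by apply: ler_weXn2l => //; lra.
rewrite mulrCA [leLHS]mulrC ler_pdivrMr ?exprn_gt0 ?mulr_gt0//.
apply: (@le_trans _ _ (eta * t)); last by rewrite ler_wpM2l// ltW.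
by rewrite -ler_pdivrMl// mulrC; lra.
Qed.

Section GlobalEstimate.
Context {R : realType} {n : nat}.
Local Notation mu := (lebesgue_row n : {measure set 'rV[R]_n -> \bar R}).
Variables (c s p q beta tau kappa a : R).
Let sigma : R := n%:R + s * p.
Let dw : R := q / p * (n%:R - s * p + beta).
Hypotheses (n0 : (0 < n)%N) (c1 : 1 <= c) (s0 : 0 < s) (p1 : 1 <= p) (pq : p <= q)
  (tau0 : 0 < tau < 1) (kappa0 : 0 < kappa) (kappat : n%:R * kappa <= tau / (24 * c))
  (adw : a < dw).

Let p0 : 0 < p. Proof. exact: lt_le_trans ltr01 p1. Qed.
Let q0 : 0 < q. Proof. exact: lt_le_trans p0 pq. Qed.
Let c0 : 0 < c. Proof. exact: lt_le_trans ltr01 c1. Qed.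
Let sigma0 : 0 < sigma. Proof. by rewrite addr_gt0 ?ltr0n ?mulr_gt0. Qed.
(** Ratio of consecutive scales: passing from scale [t] to [h t] moves the point on the curve by at
    most [tau t / (24 c)], a small fraction of the radius of the ball in the energy. *)
Let h : R := 1 + tau / (24 * c).
Let tc0 : 0 < tau / (24 * c).
Proof. by case/andP: tau0 => t0 _; rewrite divr_gt0// mulr_gt0. Qed.
Let h1 : 1 < h. Proof. by rewrite ltrDl. Qed.

(** Decay exponent of the chain terms, positive because [a < dw]. *)
Let omega : R := (dw - a) / q.
Let A4 : R := (2 * kappa) `^ (- n%:R) * (2 * kappa) `^ (- n%:R) *
  (4 * c) `^ `|beta| * ((4 * c) `^ `|a|) `^ (p / q).
Let C4 : R := 2 * A4 `^ p^-1.

Let A40 : 0 <= A4.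
Proof. by rewrite !mulr_ge0 ?powR_ge0. Qed.

(** Collects the powers of [t]: the exponent is [- n + sigma - n - beta + a p / q], which is
    [- omega p] by the definition of [dw]. *)
Let scale_eq (t k L : R) : 0 < t -> 0 <= k -> 0 < L ->
  (2 * (kappa * t)) ^- n * t `^ sigma * ((2 * (kappa * t)) ^- n *
    ((4 * c) `^ `|beta| * t `^ (- beta) *
     (L `^ (1 - p / q) * ((4 * c) `^ `|a| * t `^ a * k) `^ (p / q)))) =
  A4 * t `^ (- (omega * p)) * (L `^ (q / p - 1) * k) `^ (p / q).
Proof.
move=> t0 k0 L0; have k20 : 0 <= 2 * kappa by rewrite mulr_ge0// ltW.
have -> : (2 * (kappa * t)) ^- n = (2 * kappa) `^ (- n%:R) * t `^ (- n%:R).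
  by rewrite mulrA -powRM ?(ltW t0)// powRN powR_mulrn// mulr_ge0 ?(ltW t0).
rewrite (powRM _ (powR_ge0 L _) k0) (powRM _ _ k0) ?mulr_ge0 ?powR_ge0//.
rewrite (powRM _ (powR_ge0 _ _) (powR_ge0 _ _)) -(powRrM L).
have -> : (q / p - 1) * (p / q) = 1 - p / q by field; rewrite !gt_eqF.
have -> : t `^ (- (omega * p)) = t `^ (- n%:R) * t `^ sigma * t `^ (- n%:R) *
    t `^ (- beta) * t `^ a `^ (p / q).
  rewrite -powRrM -!powRD_gt0//; congr (_ `^ _).
  by rewrite /omega /dw /sigma; field; rewrite !gt_eqF.
by rewrite /A4; ring.
Qed.

Let hq : R := h `^ (- omega).
Let C5 : R := C4 / (1 - hq).

Let omega0 : 0 < omega. Proof. by rewrite divr_gt0// subr_gt0. Qed.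

Let hq01 : 0 <= hq < 1.
Proof.
have h0 : 0 < h by exact: lt_trans h1.
by rewrite powR_ge0 /= /hq powRN invf_lt1 ?powR_gt0// powR_gt1.
Qed.

Let C40 : 0 <= C4. Proof. by rewrite mulr_ge0 ?powR_ge0. Qed.

Let C50 : 0 <= C5.
Proof. by rewrite divr_ge0// subr_ge0 ltW//; case/andP: hq01. Qed.

Section Chain.
Variable D : set 'rV[R]_n.
Hypotheses (Dj : john_domain c D) (ubD : ~ bounded_set D).
Local Notation delta := (@delta_bd R n D).
Implicit Types x y z : 'rV[R]_n.

Lemma john_open : open D. Proof. by case: Dj => -[]. Qed.
Lemma john_proper : D <> setT. Proof. by case: Dj. Qed.

(* The curve is sampled at times [h^i delta(x) - delta(x)], so that the point
   with index 0 is [x] and the distance to the boundary is comparable to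
   [h^i delta(x)] from the start. *)
Lemma john_chain x I : D x -> exists y : nat -> 'rV[R]_n,
  [/\ y 0%N = x,
    forall i, (i <= I)%N -> [/\ D (y i), h ^+ i * delta x / (3 * c) <= delta (y i) &
      enorm (x - y i) <= h ^+ i * delta x] &
    forall i, (i < I)%N -> enorm (y i.+1 - y i) <= tau / (24 * c) * (h ^+ i * delta x)].
Proof.
move=> Dx; have D0 : D !=set0 by exists x.
have dx0 := delta_bd_gt0 john_open D0 john_proper Dx.
pose t i := h ^+ i * delta x.
have t_ge i : delta x <= t i by rewrite ler_peMl ?(ltW dx0)// exprn_ege1// ltW.
have t_le i j : (i <= j)%N -> t i <= t j.
  by move=> ij; rewrite ler_wpM2r ?(ltW dx0)//; apply: ler_weXn2l => //; exact: ltW.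
have T0 : 0 <= t I - delta x by rewrite subr_ge0.
have [gamma [g0 gD gL]] := john_ray Dj c1 ubD Dx T0.
exists (fun i => gamma (t i - delta x)); split.
- by rewrite /t expr0 mul1r subrr.
- move=> i iI; have ti := t_ge i; have tiI := t_le _ _ iI.
  have t01 : 0 <= t i - delta x <= t I - delta x by rewrite subr_ge0 ti lerB.
  have [Dg dg] := gD _ t01.
  have xg : enorm (x - gamma (t i - delta x)) <= t i - delta x.
    by rewrite enormB -[X in gamma _ - X]g0 -[leRHS]subr0; apply: gL => //; case/andP: t01.
  split=> //; last by rewrite -/(t i); lra.
  rewrite -/(t i) ler_pdivrMr ?mulr_gt0//.
  rewrite ler_pdivrMr// in dg.
  have := delta_bd_lipschitz john_open D0 john_proper x (gamma (t i - delta x)).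
  set d := delta (gamma _) in dg *; move=> dl.
  have dc : d <= d * c.
    by rewrite ler_peMr//; apply/ltW/(delta_bd_gt0 john_open D0 john_proper).
  (* Early on the curve [x] is still close and the Lipschitz bound suffices; later the John
     condition does. Cutting at [delta x / 2] yields the factor 3 in both cases. *)
  by have [?|?] := leP (t i - delta x) (delta x / 2); lra.
- move=> i iI; have tii : t i <= t i.+1 by exact: t_le.
  apply: le_trans (gL _ _ _ _ _) _.
  + by rewrite subr_ge0.
  + by rewrite lerB.
  + by rewrite lerB// t_le.
  by rewrite /t exprS /h; lra.
Qed.

Section FixedFunction.
Variables (u : 'rV[R]_n -> R) (u_meas : measurable_fun setT u).
Local Notation rho := (fun z => tau * delta z).
Local Notation G := (energy p sigma u rho).
Local Notation avg := (box_avg (fun b => `|u b|%:E)).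

(** Records what all points of the boxes of a chain from [x] have in common, without reference to
    the curve. Being a measurable relation between [x] and [z], it allows the integrals to be
    exchanged. *)
Definition john_near x z : bool :=
  (enorm (x - z) <= 8 * c * delta z) && (delta x <= 8 * c * delta z).

(** The function P of the outline above. *)
Definition john_potential x : \bar R :=
  (\int[mu]_(z in D) if john_near x z
    then G z * (delta z `^ beta)%:E * (delta z `^ (- a))%:E else 0)%E.

Lemma chain_box x y t z : D x -> D y -> 0 < t -> delta x <= t ->
  t / (3 * c) <= delta y -> enorm (x - y) <= t -> box y (kappa * t) z ->
  [/\ D z, t / (4 * c) <= delta z <= 4 * c * t,
    tau / (6 * c) * t < rho z, john_near x z & enorm (z - y) <= tau / (24 * c) * t].
Proof.
move=> Dx Dy t0 xt ty xy yz; have D0 : D !=set0 by exists x.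
have [t00 t01] := andP tau0.
have zy : enorm (z - y) <= tau / (24 * c) * t.
  apply: le_trans (box_enorm _ yz) _; first by rewrite mulr_ge0// ltW.
  by rewrite mulrA ler_wpM2r// ltW.
have tc : tau / (24 * c) * t <= t / c / 24.
  rewrite (_ : t / c / 24 = (24 * c)^-1 * t); last by field; rewrite gt_eqF.
  by rewrite ler_wpM2r ?(ltW t0)// ler_piMl ?invr_ge0 ?mulr_ge0 ?(ltW c0)// ltW.
have ctc : t / c <= t by rewrite ler_pdivrMr// ler_peMr// ltW.
have tc0' : 0 < t / c by rewrite divr_gt0.
have e3 : t / (3 * c) = t / c / 3 by field; rewrite gt_eqF.
have e4 : t / (4 * c) = t / c / 4 by field; rewrite gt_eqF.
have l1 := delta_bd_lipschitz john_open D0 john_proper z y.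
have l2 := delta_bd_lipschitz john_open D0 john_proper y z.
have l3 := delta_bd_lipschitz john_open D0 john_proper y x.
have xz := ler_enormB x z y.
rewrite [enorm (y - z)]enormB in l2 xz.
rewrite [enorm (y - x)]enormB in l3.
rewrite e3 in ty.
(* Here [7/24 = 1/3 - 1/24]: the distance of [y] to the boundary minus the radius of the box. It
   exceeds the [1/4] and [1/6] needed below, and 8 times it exceeds 2. *)
have dz : t / c * (7 / 24) <= delta z by lra.
have dzc : 2 * t <= 8 * c * delta z.
  have : t / c * (7 / 24) * (8 * c) <= delta z * (8 * c).
    by rewrite ler_wpM2r// mulr_ge0// ltW.
  rewrite (_ : t / c * (7 / 24) * (8 * c) = t * (7 / 3)); last by field; rewrite gt_eqF.
  lra.
have c4 : 4 * t <= 4 * c * t by rewrite (ler_wpM2r (ltW t0))// ler_peMr.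
split=> //.
- by apply: (eball_delta_bd john_open Dy); rewrite /eball /=; lra.
- by rewrite e4; lra.
- have : tau * (t / c * (7 / 24)) <= tau * delta z by rewrite ler_wpM2l// ltW.
  apply: lt_le_trans.
  rewrite (_ : tau / (6 * c) * t = tau * (t / c) * 6^-1); last by field; rewrite gt_eqF.
  have : 0 < tau * (t / c) by rewrite mulr_gt0.
  lra.
- by apply/andP; split; lra.
Qed.

Let rho_meas (D0 : D !=set0) : measurable_fun setT rho.
Proof.
apply: measurable_funM => //; exact: measurable_delta_bd john_open D0 john_proper.
Qed.

Lemma measurable_john_near x (D0 : D !=set0) : measurable_fun setT (john_near x).
Proof.
have md := measurable_delta_bd john_open D0 john_proper.
have m8 : measurable_fun setT (fun z => 8 * c * delta z) by exact: measurable_funM.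
apply: measurable_and; apply: measurable_fun_ler => //.
by apply: measurable_enorm => i; exact: measurable_coordB.
Qed.

Lemma measurable_weighted_energy (D0 : D !=set0) (e : R) :
  measurable_fun setT (fun z => G z * (delta z `^ e)%:E)%E.
Proof.
apply: emeasurable_funM; first by apply: measurable_energy => //; exact: rho_meas.
exact: measurable_delta_bd_powR john_open D0 john_proper e.
Qed.

Lemma weighted_energy_ge0 e z : (0 <= G z * (delta z `^ e)%:E)%E.
Proof. by rewrite mule_ge0 ?energy_ge0// lee_fin powR_ge0. Qed.

(** Let [V] be the energy of the box weighted by [delta^beta]. It is at most [L], and also at most a
    multiple of [t^a k], since [john_near x] holds on the whole box. Interpolation with exponent
    [p / q] combines both bounds, and removing the weight costs a multiple of [t^(- beta)]. *)
Lemma chain_energy x y (t k L : R) : D x -> D y -> 0 < t -> delta x <= t ->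
  t / (3 * c) <= delta y -> enorm (x - y) <= t -> 0 <= k ->
  (john_potential x <= k%:E)%E ->
  (\int[mu]_(z in D) (G z * (delta z `^ beta)%:E) <= L%:E)%E ->
  (\int[mu]_(z in box y (kappa * t)) G z <= ((4 * c) `^ `|beta| * t `^ (- beta) *
     (L `^ (1 - p / q) * ((4 * c) `^ `|a| * t `^ a * k) `^ (p / q)))%:E)%E.
Proof.
move=> Dx Dy t0 xt ty xy k0 Kk GL; have D0 : D !=set0 by exists x.
have H z : box y (kappa * t) z -> _ := @chain_box x y t z Dx Dy t0 xt ty xy.
have mB := @measurable_box R n y (kappa * t).
have c41 : 1 <= 4 * c by have := c1; lra.
have mG : measurable_fun setT G by apply: measurable_energy => //; exact: rho_meas.
have HB z : box y (kappa * t) z -> t / (4 * c) <= delta z <= 4 * c * t by case/H.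
have mGb := measurable_weighted_energy D0 beta.
have V1 := integral_weight_le john_open D0 john_proper (- beta) mB mG
  (energy_ge0 p sigma u rho) t0 c41 HB.
have V2 := integral_weight_le john_open D0 john_proper a mB mGb
  (weighted_energy_ge0 beta) t0 c41 HB.
rewrite opprK normrN in V1.
set V := (\int[mu]_(z in box y (kappa * t)) (G z * (delta z `^ beta)%:E))%E in V1 V2.
have mN := measurable_john_near x D0.
have mp : measurable_fun setT (fun z => G z * (delta z `^ beta)%:E * (delta z `^ (- a))%:E)%E.
  apply: emeasurable_funM => //.
  exact: measurable_delta_bd_powR john_open D0 john_proper _.
have p00 z : (0 <= G z * (delta z `^ beta)%:E * (delta z `^ (- a))%:E)%E.
  by rewrite mule_ge0 ?weighted_energy_ge0// lee_fin powR_ge0.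
have V3 : (\int[mu]_(z in box y (kappa * t))
    (G z * (delta z `^ beta)%:E * (delta z `^ (- a))%:E) <= k%:E)%E.
  apply: le_trans Kk; rewrite /john_potential.
  rewrite (eq_integral (fun z => if john_near x z
    then G z * (delta z `^ beta)%:E * (delta z `^ (- a))%:E else 0)%E); last first.
    by move=> z; rewrite inE => /H[_ _ _ ->].
  apply: ge0_subset_integral => //.
  - by apply: open_row_measurable; exact: john_open.
  - by apply: measurable_funTS; apply: measurable_fun_ifT.
  - by move=> z _; case: ifP => // _; exact: p00.
  - by move=> z /H[].
have V0 : (0 <= V)%E by apply: integral_ge0 => z _; exact: weighted_energy_ge0.
have VL : (V <= L%:E)%E.
  apply: le_trans GL; apply: ge0_subset_integral => //.
  - by apply: open_row_measurable; exact: john_open.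
  - exact: measurable_funTS.
  - by move=> z _; exact: weighted_energy_ge0.
  - by move=> z /H[].
apply: le_trans V1 _; rewrite [leRHS]EFinM; apply: lee_wpmul2l.
  by rewrite lee_fin mulr_ge0 ?powR_ge0.
have : (V <= ((4 * c) `^ `|a| * t `^ a * k)%:E)%E.
  apply: le_trans V2 _; rewrite [leRHS]EFinM; apply: lee_wpmul2l => //.
  by rewrite lee_fin mulr_ge0 ?powR_ge0.
move: V0 VL; case: V {V2} => // v; rewrite !lee_fin => v0 vL vk.
apply: interpolation_le => //.
by rewrite divr_ge0 ?(ltW p0) ?(ltW q0)//= ler_pdivrMr// mul1r.
Qed.

Lemma chain_step x y y' (t k L : R) : D x -> D y -> D y' -> 0 < t -> delta x <= t ->
  t / (3 * c) <= delta y -> enorm (x - y) <= t ->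
  h * t / (3 * c) <= delta y' -> enorm (x - y') <= h * t ->
  enorm (y' - y) <= tau / (24 * c) * t -> 0 <= k -> 0 < L ->
  (john_potential x <= k%:E)%E ->
  (\int[mu]_(z in D) (G z * (delta z `^ beta)%:E) <= L%:E)%E ->
  (avg y (kappa * t) <= (C4 * ((L `^ (q / p - 1) * k) `^ q^-1 * t `^ (- omega)))%:E
     + avg y' (kappa * (h * t)))%E.
Proof.
move=> Dx Dy Dy' t0 xt ty xy ty' xy' yy' k0 L0 Kk GL; have D0 : D !=set0 by exists x.
have ht : t <= h * t by rewrite ler_peMl ?(ltW t0)// ltW.
have ht0 : 0 < h * t by exact: lt_le_trans ht.
have kt0 : 0 < kappa * t by rewrite mulr_gt0.
have kht0 : 0 < kappa * (h * t) by rewrite mulr_gt0.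
have [t00 t01] := andP tau0.
have pair z : box y (kappa * t) z -> forall w, box y' (kappa * (h * t)) w ->
    enorm (z - w) <= t /\ eball z (rho z) w.
  move=> yz w yw; have [_ _ rz _ zy] := chain_box Dx Dy t0 xt ty xy yz.
  have [_ _ _ _ wy] := chain_box Dx Dy' ht0 (le_trans xt ht) ty' xy' yw.
  have h2 : tau / (24 * c) * (h * t) <= tau / (24 * c) * (2 * t).
    rewrite (ler_wpM2l (ltW tc0))// (ler_wpM2r (ltW t0))// /h.
    rewrite (_ : 2 = 1 + 1)// lerD2l ler_pdivrMr ?mulr_gt0// mul1r.
    have := c1; lra.
  (* In units of [tau t / (24 c)]: 1 from [z] to [y], 1 from [y] to [y'], and at most 2 from [y'] to
     [w], because [h <= 2]. *)
  have zw : enorm (z - w) <= tau / (6 * c) * t.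
    have := ler_enormB z w y; have := ler_enormB y w y'.
    rewrite [enorm (y' - w)]enormB [enorm (y - y')]enormB.
    rewrite (_ : tau / (6 * c) * t = tau / (24 * c) * (4 * t)); last first.
      by field; rewrite gt_eqF.
    by lra.
  split; last by rewrite /eball /= enormB; apply: le_lt_trans rz.
  apply: le_trans zw _; rewrite ler_piMl ?(ltW t0)// ler_pdivrMr ?mulr_gt0// mul1r.
  have := c1; lra.
set Q := ((4 * c) `^ `|beta| * t `^ (- beta) *
     (L `^ (1 - p / q) * ((4 * c) `^ `|a| * t `^ a * k) `^ (p / q))).
have Q0 : 0 <= Q by rewrite !mulr_ge0 ?powR_ge0.
have v0 : 0 <= (2 * (kappa * t)) ^- n.
  by rewrite invr_ge0 exprn_ge0// mulr_ge0// ltW.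
have v'0 : 0 <= (2 * (kappa * (h * t))) ^- n.
  by rewrite invr_ge0 exprn_ge0// mulr_ge0// ltW.
have EQ := chain_energy Dx Dy t0 xt ty xy k0 Kk GL.
apply: le_trans (box_avg_le_box_avg p1 sigma0 u_meas (rho_meas D0) kt0 kht0 t0 Q0 pair EQ) _.
apply: leeD2r; rewrite lee_fin -[leRHS]mulrA; apply: ler_wpM2l => //.
(* The volume of the larger box is replaced by that of the smaller one, so that [scale_eq]
   applies. *)
apply: (@le_trans _ _ ((A4 * t `^ (- (omega * p)) * (L `^ (q / p - 1) * k) `^ (p / q)) `^ p^-1)).
  apply: ler_powR_base; first by rewrite invr_ge0 ltW.
    by rewrite (mulr_ge0 (mulr_ge0 v'0 (powR_ge0 _ _)) (mulr_ge0 v0 Q0)).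
  rewrite -scale_eq// -/Q -!mulrA; apply: ler_wpM2r.
    by rewrite (mulr_ge0 (powR_ge0 _ _) (mulr_ge0 v0 Q0)).
  have k2 : 2 * (kappa * t) <= 2 * (kappa * (h * t)).
    by rewrite ler_pM2l// ler_pM2l.
  have kt2 : 0 < 2 * (kappa * t) by rewrite mulr_gt0.
  have kht2 : 0 < 2 * (kappa * (h * t)) by rewrite mulr_gt0.
  rewrite lef_pV2 ?posrE ?(exprn_gt0 _ kt2) ?(exprn_gt0 _ kht2)//.
  by apply: lerXn2r; rewrite ?nnegrE ?(ltW kt2) ?(ltW kht2).
have LK0 : 0 <= L `^ (q / p - 1) * k by rewrite mulr_ge0 ?powR_ge0.
rewrite (powRM _ (mulr_ge0 A40 (powR_ge0 _ _)) (powR_ge0 _ _)).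
rewrite (powRM _ A40 (powR_ge0 _ _)) -!powRrM le_eqVlt; apply/orP; left; apply/eqP.
rewrite mulrAC -mulrA; congr (_ * (_ `^ _ * _ `^ _)).
  by field; rewrite !gt_eqF.
by field; rewrite gt_eqF.
Qed.

(** The bounds of [chain_step] form a geometric series of ratio [hq], whose sum is bounded
    independently of the number of steps. The chain therefore runs until [box_avg_tail] makes the
    last average at most [e], and [e] is arbitrary. *)
Lemma global_estimate_fixed x (k L r B : R) : D x -> 0 <= k -> 0 < L ->
  (john_potential x <= k%:E)%E ->
  (\int[mu]_(z in D) (G z * (delta z `^ beta)%:E) <= L%:E)%E ->
  1 <= r -> (\int[mu]_z (`|u z| `^ r)%:E <= B%:E)%E ->
  (avg x (kappa * delta x) <=
     (C5 * (L `^ (q / p - 1) * k * delta x `^ (a - dw)) `^ q^-1)%:E)%E.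
Proof.
move=> Dx k0 L0 Kk GL r1 uB; have D0 : D !=set0 by exists x.
have dx0 := delta_bd_gt0 john_open D0 john_proper Dx.
have h0 : 0 < h by exact: lt_trans h1.
set Y := (L `^ (q / p - 1) * k) `^ q^-1.
have Y0 : 0 <= Y by exact: powR_ge0.
have -> : (L `^ (q / p - 1) * k * delta x `^ (a - dw)) `^ q^-1 = Y * delta x `^ (- omega).
  rewrite powRM ?mulr_ge0 ?powR_ge0// -powRrM; congr (_ * _ `^ _).
  by rewrite /omega; field; rewrite gt_eqF.
apply/lee_addgt0Pr => e e0; have e20 : 0 < e / 2 by rewrite divr_gt0.
have [t0 t00 tail] := box_avg_tail n0 u_meas r1 e20 uB.
have [I hI] : exists I, t0 <= kappa * (h ^+ I * delta x).
  have hv : `|h^-1| < 1 by rewrite ger0_norm ?invr_ge0 ?(ltW h0)// invf_lt1.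
  have kt : 0 < kappa * delta x / t0 by rewrite divr_gt0 ?mulr_gt0.
  have /cvgrPdist_lt /(_ _ kt)[I _ /(_ I (leqnn I))] := cvg_expr hv.
  rewrite sub0r normrN ger0_norm ?exprn_ge0 ?invr_ge0 ?(ltW h0)// => H.
  exists I; move: (ltW H); rewrite ler_pdivlMr// exprVn mulrC ler_pdivrMr ?exprn_gt0//.
  by rewrite mulrCA mulrC.
have [y [y0 yD yS]] := john_chain I Dx.
have step j : (j <= I)%N -> (avg x (kappa * delta x) <=
    (C4 * (Y * delta x `^ (- omega)) * \sum_(i < j) hq ^+ i)%:E
    + avg (y j) (kappa * (h ^+ j * delta x)))%E.
  elim: j => [_|j IH jI]; first by rewrite big_ord0 mulr0 add0e y0 expr0 mul1r.
  have jI' := ltnW jI; have [Dj1 dj1 xj1] := yD _ jI'; have [Dj2 dj2 xj2] := yD _ jI.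
  rewrite exprS -(mulrA h) in dj2 xj2.
  have ht0 : 0 < h ^+ j * delta x by rewrite mulr_gt0// exprn_gt0.
  have xt : delta x <= h ^+ j * delta x by rewrite ler_peMl ?(ltW dx0)// exprn_ege1// ltW.
  have := chain_step Dx Dj1 Dj2 ht0 xt dj1 xj1 dj2 xj2 (yS _ jI) k0 L0 Kk GL.
  rewrite -/Y => st; apply: le_trans (IH jI') _; apply: le_trans (leeD2l _ st) _.
  rewrite addeA -EFinD exprS -(mulrA h); apply: leeD2r.
  rewrite lee_fin big_ord_recr /= mulrDr lerD2l le_eqVlt; apply/orP; left; apply/eqP.
  rewrite powRM ?exprn_ge0 ?(ltW h0) ?(ltW dx0)//.
  rewrite (_ : (h ^+ j) `^ (- omega) = hq ^+ j); first by ring.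
  by rewrite -(powR_mulrn _ (ltW h0)) -powRrM mulrC powRrM powR_mulrn ?powR_ge0.
apply: le_trans (step I (leqnn I)) _; apply: leeD.
  rewrite lee_fin /C5 [leRHS]mulrAC; apply: ler_wpM2l; last exact: geometric_sum_le.
  by rewrite mulr_ge0// mulr_ge0 ?powR_ge0.
by apply: le_trans (tail _ _ hI) _; rewrite lee_fin mulrC divfK.
Qed.

End FixedFunction.
End Chain.

Lemma global_estimate : exists2 C : R, 0 <= C &
  forall (D : set 'rV[R]_n) (u : 'rV[R]_n -> R) x (k L r B : R),
  john_domain c D -> ~ bounded_set D -> measurable_fun setT u -> D x ->
  0 <= k -> 0 < L -> (john_potential D u x <= k%:E)%E ->
  (\int[mu]_(z in D) (energy p sigma u (fun z => (tau * delta_bd D z)%R) z *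
      (delta_bd D z `^ beta)%:E) <= L%:E)%E ->
  1 <= r -> (\int[mu]_z (`|u z| `^ r)%:E <= B%:E)%E ->
  (box_avg (fun b => `|u b|%:E) x (kappa * delta_bd D x) <=
     (C * (L `^ (q / p - 1) * k * delta_bd D x `^ (a - dw)) `^ q^-1)%:E)%E.
Proof.
exists C5 => // D u x k L r B Dj ubD u_meas Dx k0 L0 Kk GL r1 uB.
exact: (global_estimate_fixed Dj ubD u_meas Dx k0 L0 Kk GL r1 uB).
Qed.

End GlobalEstimate.

(** * Integration over the domain *)

Section Tonelli.
Context {R : realType} {n : nat} (c : R) (D : set 'rV[R]_n).
Hypotheses (Dj : john_domain c D) (D0 : D !=set0).
Local Notation mu := (lebesgue_row n : {measure set 'rV[R]_n -> \bar R}).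
Local Notation delta := (@delta_bd R n D).

Let oD : open D := john_open Dj.
Let DT : D <> setT := john_proper Dj.
Let mD : measurable D := open_row_measurable oD.

Let measurable_john_near2 : measurable_fun setT
  (fun w : 'rV[R]_n * 'rV[R]_n => john_near c D w.1 w.2).
Proof.
have md := measurable_delta_bd oD D0 DT.
have m8 : measurable_fun setT (fun w : 'rV[R]_n * 'rV[R]_n => 8 * c * delta w.2).
  by apply: measurable_funM => //; exact: (measurableT_comp md measurable_snd).
apply: measurable_and; apply: measurable_fun_ler => //.
  apply: measurable_enorm => i; apply: measurable_coordB.
    exact: measurable_fst.
  exact: measurable_snd.
exact: (measurableT_comp md measurable_fst).
Qed.

Variables f g : 'rV[R]_n -> \bar R.
Hypotheses (mf : measurable_fun setT f) (mg : measurable_fun setT g).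
Hypotheses (f0 : forall z, (0 <= f z)%E) (g0 : forall z, (0 <= g z)%E).

Let fD z := (f \_ D) z.
Let gD z := (g \_ D) z.

Let mfD : measurable_fun setT fD.
Proof. by apply/(measurable_restrictT _ mD); exact: measurable_funTS. Qed.

Let mgD : measurable_fun setT gD.
Proof. by apply/(measurable_restrictT _ mD); exact: measurable_funTS. Qed.

Let fD0 z : (0 <= fD z)%E.
Proof. by rewrite /fD patchE; case: ifP. Qed.

Let gD0 z : (0 <= gD z)%E.
Proof. by rewrite /gD patchE; case: ifP. Qed.

(** Both densities are cut off to [D], so that one function on the full product carries both
    iterated integrals. *)
Let F (w : 'rV[R]_n * 'rV[R]_n) : \bar R :=
  if john_near c D w.1 w.2 then (gD w.1 * fD w.2)%E else 0%E.

Let mF : measurable_fun setT F.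
Proof.
apply: measurable_fun_ifT => //; apply: emeasurable_funM.
  exact: (measurableT_comp mgD measurable_fst).
exact: (measurableT_comp mfD measurable_snd).
Qed.

Let F0 (w : 'rV[R]_n * 'rV[R]_n) : (0 <= F w)%E.
Proof. by rewrite /F; case: ifP => // _; exact: mule_ge0. Qed.

Let near_fE x : (\int[mu]_(z in D) (if john_near c D x z then f z else 0) =
  \int[mu]_z (if john_near c D x z then fD z else 0))%E.
Proof.
rewrite integral_mkcond; apply: eq_integral => z _; rewrite /fD !patchE.
by case: ifP => //; case: ifP.
Qed.

Let near_FE x : (gD x * \int[mu]_(z in D) (if john_near c D x z then f z else 0) =
  \int[mu]_z F (x, z))%E.
Proof.
rewrite near_fE -ge0_integralZl//.
- by apply: eq_integral => z _; rewrite /F /=; case: ifP; rewrite ?mule0.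
- by apply: measurable_fun_ifT => //; exact: measurable_john_near.
- by move=> z _; case: ifP.
Qed.

Lemma measurable_near_integral : measurable_fun D
  (fun x => g x * \int[mu]_(z in D) (if john_near c D x z then f z else 0))%E.
Proof.
have := @measurable_fun_fubini_tonelli_F _ _ _ _ R (lebesgue_row n) F mF F0.
move=> /(measurable_funTS (D := D)); apply: eq_measurable_fun => x xD.
by rewrite /fubini_F -near_FE /gD patchE xD.
Qed.

Local Notation near_set z := [set x | [/\ D x,
  (enorm (x - z) <= 8 * c * delta z)%R & (delta x <= 8 * c * delta z)%R]].

Let near_FE_r z : D z -> (\int[mu]_x F (x, z) = f z * \int[mu]_(x in near_set z) g x)%E.
Proof.
move=> Dz; have zD := mem_set Dz.
have mS : measurable (near_set z).
  have mz : measurable_fun setT (fun x => john_near c D x z).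
    have m1 : measurable_fun setT (fun x : 'rV[R]_n => (x, z)).
      by apply: measurable_fun_pair; [exact: measurable_id|exact: measurable_cst].
    exact: (measurableT_comp measurable_john_near2 m1).
  rewrite (_ : [set x | _] = D `&` (fun x => john_near c D x z) @^-1` [set true]).
    by apply: measurableI => //; rewrite -[X in measurable X]setTI; exact: mz.
  apply/seteqP; split => x /=.
    by move=> [Dx xz dxz]; split=> //; apply/andP.
  by move=> [Dx /andP[]].
rewrite [X in _ = (_ * X)%E]integral_mkcond -ge0_integralZl//.
- apply: eq_integral => x _; rewrite /F /= /gD /fD !patchE zD /john_near.
  case: (boolP (x \in D)) => xD; last first.
    rewrite mul0e if_same ifF ?mule0//; apply: memNset => -[Dx _ _].
    by rewrite mem_set in xD.
  case: ifPn => [/andP[xz dxz]|nxz].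
    rewrite ifT; first exact: muleC.
    by apply: mem_set; split=> //; exact: set_mem.
  rewrite ifF ?mule0//; apply: memNset => -[_ xz dxz].
  by rewrite xz dxz in nxz.
- by apply/(measurable_restrictT _ mS); exact: measurable_funTS.
- by move=> x _; rewrite patchE; case: ifP.
Qed.

Lemma measurable_near_integral_r : measurable_fun D
  (fun z => f z * \int[mu]_(x in near_set z) g x)%E.
Proof.
have := @measurable_fun_fubini_tonelli_G _ _ _ _ R (lebesgue_row n) F mF F0.
move=> /(measurable_funTS (D := D)); apply: eq_measurable_fun => z /set_mem Dz.
by rewrite /fubini_G near_FE_r.
Qed.

Lemma near_tonelli :
  (\int[mu]_(x in D) (g x * \int[mu]_(z in D) (if john_near c D x z then f z else 0)) =
   \int[mu]_(z in D) (f z * \int[mu]_(x in near_set z) g x))%E.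
Proof.
transitivity (\int[mu]_x \int[mu]_z F (x, z))%E.
  rewrite integral_mkcond; apply: eq_integral => x _; rewrite -near_FE /gD !patchE.
  by case: ifP; rewrite ?mul0e.
rewrite (fubini_tonelli (m1 := lebesgue_row n) (m2 := lebesgue_row n) F mF F0).
rewrite [RHS]integral_mkcond; apply: eq_integral => z _.
rewrite patchE; case: ifPn => zD; last first.
  rewrite (eq_integral (cst 0%E)) ?integral0// => x _.
  by rewrite /F /fD /= patchE (negbTE zD) mule0; case: ifP.
rewrite near_FE_r//; exact: set_mem.
Qed.

End Tonelli.

(** * Combining the local and global estimates, and integrating them *)

Section Assembly.
Context {R : realType} {n : nat}.
Local Notation mu := (lebesgue_row n : {measure set 'rV[R]_n -> \bar R}).
Variables (c s p q beta tau a : R).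
Hypotheses (n0 : (0 < n)%N) (c1 : 1 <= c) (s0 : 0 < s) (p1 : 1 <= p) (pq : p <= q)
  (spn : s * p < n%:R) (qps : q <= n%:R * p / (n%:R - s * p))
  (tau0 : 0 < tau < 1).
Let sigma : R := n%:R + s * p.
Let dw : R := q / p * (n%:R - s * p + beta).
Hypothesis adw : a < dw.

Let p0 : 0 < p. Proof. exact: lt_le_trans ltr01 p1. Qed.
Let q0 : 0 < q. Proof. exact: lt_le_trans p0 pq. Qed.
Let c0 : 0 < c. Proof. exact: lt_le_trans ltr01 c1. Qed.

Definition weighted_energy (D : set 'rV[R]_n) (u : 'rV[R]_n -> R) z : \bar R :=
  (energy p sigma u (fun z => (tau * delta_bd D z)%R) z * (delta_bd D z `^ beta)%:E)%E.

(** After the exchange of integrals, the inner one runs over the set of [integral_delta_bd_le] with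
    [t = 8 c delta(z)]. Its bound, a multiple of [delta(z)^a], cancels the weight [delta(z)^(- a)]
    of the potential. *)
Lemma integral_john_potential_le (alpha K : R) : 1 <= K -> 0 <= alpha -> alpha < a ->
  exists2 C : R, 0 <= C & forall (D : set 'rV[R]_n) (u : 'rV[R]_n -> R),
  john_domain c D -> D !=set0 -> assouad_cover (boundary D) alpha K ->
  measurable_fun setT u ->
  (\int[mu]_(x in D) ((delta_bd D x `^ (a - n%:R))%:E *
      john_potential c s p beta tau a D u x) <=
   C%:E * \int[mu]_(z in D) weighted_energy D u z)%E.
Proof.
move=> K1 al0 ala; have [C C0 HC] := integral_delta_bd_le (n := n) K1 al0 ala.
have C80 : 0 <= C * (8 * c) `^ a by rewrite mulr_ge0 ?powR_ge0// ltW.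
exists (C * (8 * c) `^ a) => // D u Dj D0 cov u_meas.
have oD := john_open Dj; have DT := john_proper Dj.
have mD := open_row_measurable oD.
have mw e := measurable_delta_bd_powR oD D0 DT e.
have mG : measurable_fun setT (weighted_energy D u).
  exact (measurable_weighted_energy s p tau Dj u_meas D0 beta).
have G0 z : (0 <= weighted_energy D u z)%E by exact: weighted_energy_ge0.
have mf : measurable_fun setT (fun z => weighted_energy D u z * (delta_bd D z `^ (- a))%:E)%E.
  exact: emeasurable_funM.
have f0 z : (0 <= weighted_energy D u z * (delta_bd D z `^ (- a))%:E)%E.
  by rewrite mule_ge0// lee_fin powR_ge0.
have g0 (z : 'rV[R]_n) : (0 <= (delta_bd D z `^ (a - n%:R))%:E)%E.
  by rewrite lee_fin powR_ge0.
rewrite /john_potential (near_tonelli Dj D0 mf (mw (a - n%:R)) f0 g0).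
rewrite -ge0_integralZl//; last exact: measurable_funTS.
apply: (@le_trans _ _ (\int[mu]_(z in D) (weighted_energy D u z *
    (delta_bd D z `^ (- a))%:E * (C * (8 * c * delta_bd D z) `^ a)%:E))%E); last first.
  rewrite le_eqVlt; apply/orP; left; apply/eqP; apply: eq_integral => z /set_mem Dz.
  have dz0 := delta_bd_gt0 oD D0 DT Dz.
  rewrite -muleA -EFinM muleC; congr (_%:E * _)%E.
  rewrite powRM ?(ltW dz0)// ?mulr_ge0// ?(ltW c0)// powRN; field.
  by rewrite gt_eqF// powR_gt0.
apply: ge0_le_integral => //.
- by move=> z _; rewrite mule_ge0 ?f0// integral_ge0// => x _; exact: g0.
- exact: (measurable_near_integral_r Dj D0 mf (mw (a - n%:R)) f0 g0).
- apply: emeasurable_funM; first exact: measurable_funTS.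
  apply/measurable_EFinP; apply: measurable_funM => //.
  apply: (measurableT_comp (measurable_powR _)); apply: measurable_funM => //.
  apply: measurable_funTS; exact: measurable_delta_bd.
move=> z Dz; apply: lee_wpmul2l => //; apply: HC => //.
have dz0 := delta_bd_gt0 oD D0 DT Dz.
by rewrite ler_peMl ?(ltW dz0)//; have := c1; lra.
Qed.

(** Add the local and the global estimate, raise to the power [q] and multiply by [delta^(dw - n)];
    the two terms then carry the weights [delta^beta] and [delta^(a - n)]. *)
Lemma pointwise_estimate : exists2 C : R, 0 < C &
  forall (D : set 'rV[R]_n) (u : 'rV[R]_n -> R) x (L r B : R),
  john_domain c D -> ~ bounded_set D -> measurable_fun setT u -> D x -> 0 < L ->
  (\int[mu]_(z in D) weighted_energy D u z <= L%:E)%E ->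
  1 <= r -> (\int[mu]_z (`|u z| `^ r)%:E <= B%:E)%E ->
  ((`|u x| `^ q * delta_bd D x `^ (dw - n%:R))%:E <= (C * L `^ (q / p - 1))%:E *
    (weighted_energy D u x +
     (delta_bd D x `^ (a - n%:R))%:E * john_potential c s p beta tau a D u x))%E.
Proof.
have n0R : 0 < n%:R :> R by rewrite ltr0n.
have [t0 t1] := andP tau0.
(* This gives equality in the condition [n kappa <= tau / (24 c)] of the global estimate; the
   condition [n kappa <= tau / 24] of the local one follows from [c >= 1]. *)
pose kappa := tau / (24 * c * n%:R).
have kappa0 : 0 < kappa by rewrite divr_gt0// !mulr_gt0.
have kt : n%:R * kappa = tau / (24 * c).
  by rewrite /kappa; field; rewrite !gt_eqF.
have kt1 : n%:R * kappa <= tau / (24 * c) by rewrite kt.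
have kt2 : n%:R * kappa <= tau / 24.
  rewrite kt ler_pM2l// lef_pV2 ?posrE ?mulr_gt0//.
  by rewrite ler_peMr.
have [C1 C10 H1] := local_estimate beta n0 s0 p1 pq spn qps tau0 kappa0 kt2.
have [C2 C20 H2] := global_estimate n0 c1 s0 p1 pq tau0 kappa0 kt1 adw.
have C120 : 0 < C1 + C2 by rewrite ltr_wpDr.
exists ((C1 + C2) `^ q); first by rewrite powR_gt0.
move=> D u x L r B Dj ubD u_meas Dx L0 GL r1 uB.
have D0 : D !=set0 by exists x.
have oD := john_open Dj; have DT := john_proper Dj.
have dx0 := delta_bd_gt0 oD D0 DT Dx.
have CL0 : 0 < (C1 + C2) `^ q * L `^ (q / p - 1) by rewrite mulr_gt0 ?powR_gt0.
rewrite /weighted_energy.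
have jp0 : (0 <= john_potential c s p beta tau a D u x)%E.
  apply: integral_ge0 => z _; case: ifP => // _.
  by rewrite !mule_ge0 ?energy_ge0// lee_fin powR_ge0.
have dxy (e : R) : (0 < (delta_bd D x `^ e)%:E)%E by rewrite lte_fin powR_gt0.
have := energy_ge0 p sigma u (fun z => tau * delta_bd D z) x.
(* If the energy or the potential is infinite at [x], so is the right side, as the weights are
   positive. *)
case Ee : (energy _ _ _ _ _) => [e| |]//= e0; last first.
  rewrite gt0_mulye// addye ?gt0_muley ?leey//.
  by rewrite gt_eqF// (@lt_le_trans _ _ 0%E)// mule_ge0// ltW.
move: jp0; case Ek : (john_potential _ _ _ _ _ _ _ _ _) => [k| |]//= k0; last first.
  by rewrite gt0_muley// -EFinM addey// gt0_muley ?leey.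
rewrite !lee_fin in e0 k0.
have Ee' := Ee; have Ek' := Ek.
have [{}Ee {}Ek] : (energy p sigma u (fun z => (tau * delta_bd D z)%R) x <= e%:E)%E /\
  (john_potential c s p beta tau a D u x <= k%:E)%E by rewrite Ee' Ek'.
have ineq1 := H1 D u x e L oD DT u_meas Dx e0 Ee L0 GL.
have ineq2 := H2 D u x k L r B Dj ubD u_meas Dx k0 L0 Ek GL r1 uB.
have := le_trans ineq1 (leeD2l _ ineq2).
rewrite -!EFinM -!EFinD !lee_fin -/dw.
set d := delta_bd D x in dx0 *; set L' := L `^ (q / p - 1).
set X1 := L' * e * _; set X2 := L' * k * _ => uX.
have X10 : 0 <= X1 by rewrite !mulr_ge0 ?powR_ge0.
have X20 : 0 <= X2 by rewrite !mulr_ge0 ?powR_ge0.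
have uX' : `|u x| <= (C1 + C2) * (X1 + X2) `^ q^-1.
  apply: le_trans uX _; rewrite mulrDl; apply: lerD.
    apply: (ler_wpM2l (ltW C10)); apply: ler_powR_base; rewrite ?lerDl//.
    by rewrite invr_ge0 ltW.
  apply: (ler_wpM2l C20); apply: ler_powR_base; rewrite ?lerDr//.
  by rewrite invr_ge0 ltW.
apply: (@le_trans _ _ (((C1 + C2) * (X1 + X2) `^ q^-1) `^ q * d `^ (dw - n%:R))).
  apply: ler_wpM2r; first exact: powR_ge0.
  by apply: ler_powR_base => //; exact: ltW.
rewrite powRM ?powR_ge0 ?(ltW C120)// -powRrM mulVf ?gt_eqF// powRr1 ?addr_ge0//.
rewrite -!mulrA; apply: ler_wpM2l; first exact: powR_ge0.
rewrite /X1 /X2 -!mulrA -mulrDr -mulrA; apply: ler_wpM2l; first exact: powR_ge0.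
rewrite mulrDl -!mulrA -!powRD_gt0//.
rewrite (_ : beta + n%:R - dw + (dw - n%:R) = beta); last by ring.
rewrite (_ : a - dw + (dw - n%:R) = a - n%:R); last by ring.
by rewrite [X in _ <= _ + X]mulrC.
Qed.

End Assembly.

Section WeightedBound.
Context {R : realType} {n : nat}.
Local Notation mu := (lebesgue_row n : {measure set 'rV[R]_n -> \bar R}).

(** In the integrated pointwise bound, the energy contributes at most [L] and the potential at most
    a multiple of [L]; the prefactor [L^(q/p - 1)] turns this into [L^(q/p)]. *)
Lemma weighted_bound (c s p q beta tau alpha K : R) :
  (0 < n)%N -> 1 <= c -> 0 < s -> 1 <= p -> p <= q -> s * p < n%:R ->
  q <= n%:R * p / (n%:R - s * p) -> 0 < tau < 1 -> 1 <= K -> 0 <= alpha ->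
  alpha < q / p * (n%:R - s * p + beta) ->
  exists2 C : R, 0 < C &
  forall (D : set 'rV[R]_n) (u : 'rV[R]_n -> R) (L r B : R),
  john_domain c D -> ~ bounded_set D -> assouad_cover (boundary D) alpha K ->
  measurable_fun setT u -> 0 < L ->
  (\int[mu]_(z in D) weighted_energy s p beta tau D u z <= L%:E)%E ->
  1 <= r -> (\int[mu]_z (`|u z| `^ r)%:E <= B%:E)%E ->
  (\int[mu]_(x in D)
     (`|u x| `^ q * delta_bd D x `^ (q / p * (n%:R - s * p + beta) - n%:R))%:E
   <= (C * L `^ (q / p))%:E)%E.
Proof.
move=> n0 c1 s0 p1 pq spn qps tau0 K1 al0.
set dw := q / p * _ => aldw.
have p0 : 0 < p by exact: lt_le_trans ltr01 p1.
(* Strictly between [alpha] and [dw]: [alpha < a] makes the sum over the layers converge, [a < dw]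
   the sum along the chain. *)
pose a := (alpha + dw) / 2.
have ala : alpha < a by rewrite /a; lra.
have adw : a < dw by rewrite /a; lra.
have [Cp Cp0 Hp] := pointwise_estimate n0 c1 s0 p1 pq spn qps tau0 adw.
have [Ca Ca0 Ha] := integral_john_potential_le (n := n) s p beta tau c1 K1 al0 ala.
exists (Cp * (1 + Ca)); first by rewrite mulr_gt0// ltr_wpDr.
move=> D u L r B Dj ubD cov u_meas L0 GL r1 uB.
have [x0 Dx0 _] := unbounded_far 0 0 ubD; have D0 : D !=set0 by exists x0.
have oD := john_open Dj; have DT := john_proper Dj.
have mD := open_row_measurable oD.
have mw e := measurable_delta_bd_powR oD D0 DT e.
have mG : measurable_fun setT (weighted_energy s p beta tau D u).
  exact (measurable_weighted_energy s p tau Dj u_meas D0 beta).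
have G0 z : (0 <= weighted_energy s p beta tau D u z)%E by exact: weighted_energy_ge0.
have mf : measurable_fun setT (fun z =>
    weighted_energy s p beta tau D u z * (delta_bd D z `^ (- a))%:E)%E.
  exact: emeasurable_funM.
have f0 z : (0 <= weighted_energy s p beta tau D u z * (delta_bd D z `^ (- a))%:E)%E.
  by rewrite mule_ge0// lee_fin powR_ge0.
have g0 (z : 'rV[R]_n) : (0 <= (delta_bd D z `^ (a - n%:R))%:E)%E.
  by rewrite lee_fin powR_ge0.
have mP := measurable_near_integral Dj D0 mf (mw (a - n%:R)) f0 g0.
have P0 z : (0 <= (delta_bd D z `^ (a - n%:R))%:E *
    john_potential c s p beta tau a D u z)%E.
  by apply: mule_ge0 => //; apply: integral_ge0 => y _; case: ifP => // _; exact: f0.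
have CL0 : 0 <= Cp * L `^ (q / p - 1) by rewrite mulr_ge0 ?powR_ge0// ltW.
apply: (@le_trans _ _ (\int[mu]_(x in D) ((Cp * L `^ (q / p - 1))%:E *
    (weighted_energy s p beta tau D u x + (delta_bd D x `^ (a - n%:R))%:E *
      john_potential c s p beta tau a D u x)))%E).
  apply: ge0_le_integral => //.
  - by move=> x _; rewrite lee_fin mulr_ge0 ?powR_ge0.
  - apply/measurable_EFinP/measurable_funTS; apply: measurable_funM.
      apply: (measurableT_comp (measurable_powR q)).
      exact: (measurableT_comp (@normr_measurable R setT)).
    by apply/measurable_EFinP; exact: mw.
  - apply: emeasurable_funM; first exact: measurable_cst.
    by apply: emeasurable_funD => //; exact: measurable_funTS.
  - by move=> x Dx; exact: (Hp D u x L r B Dj ubD u_meas Dx L0 GL r1 uB).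
rewrite ge0_integralZl//; last 2 first.
- by apply: emeasurable_funD => //; exact: measurable_funTS.
- by move=> x _; rewrite adde_ge0.
rewrite ge0_integralD//; last exact: measurable_funTS.
have -> : Cp * (1 + Ca) * L `^ (q / p) = Cp * L `^ (q / p - 1) * (L + Ca * L).
  rewrite -[in LHS](subrK 1 (q / p)) powRD_gt0// powRr1 ?(ltW L0)//; ring.
rewrite [leRHS]EFinM; apply: lee_wpmul2l => //; rewrite EFinD; apply: leeD => //.
apply: le_trans (Ha D u Dj D0 cov u_meas) _; rewrite EFinM.
exact: lee_wpmul2l.
Qed.

End WeightedBound.

(** * The weighted inequality for functions in L^r of a John domain *)

Unset Implicit Arguments.
Set Strict Implicit.
Set Printing Implicit Defensive.

(* C is chosen before D, so it is uniform over all domains with the same c, tau,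
   beta, s, p, q, n and the same Assouad data (alpha, K) of the boundary.  Such
   data exist for every D with assouad_dim (boundary D) below the threshold, and C
   has to depend on them: it is unbounded over the complements of the finite sets
   {(i/k, 0) : i <= k} in R^2, which are uniformly John with boundary of
   dimension 0 (p = q = 2, s = 1/2, beta = - 1/2). *)
Theorem theorem3p1 (R : realType) (n : nat) (c s p q beta tau alpha K : R)
    (hn : (2 <= n)%N) (hc : 1 <= c) (hs : 0 < s < 1)
    (hp : 1 < p) (hpq : p <= q)
    (hsp : s * p < n%:R) (hq : q <= n%:R * p / (n%:R - s * p))
    (htau : 0 < tau < 1)
    (halpha : 0 <= alpha < Num.min (q / p * (n%:R - s * p + beta))
                                   (n%:R - beta / (p - 1)))
    (hK : 1 <= K) :
  exists2 C : R, 0 < C &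
    forall D : set 'rV[R]_n,
      john_domain c D -> ~ bounded_set D ->
      (assouad_dim (boundary D) <
        (Num.min (q / p * (n%:R - s * p + beta)) (n%:R - beta / (p - 1)))%:E)%E ->
      assouad_cover (boundary D) alpha K ->
      forall u : 'rV[R]_n -> R, (exists2 r : R, 1 <= r & in_Lr D r u) ->
      ((\int[lebesgue_row n]_(x in D)
          (`|u x| `^ q * delta_bd D x `^ (q / p * (n%:R - s * p + beta) - n%:R))%:E)
        `^ (p / q)
       <= C%:E * \int[lebesgue_row n]_(x in D)
            ((\int[lebesgue_row n]_(y in eball x (tau * delta_bd D x))
                (`|u x - u y| `^ p / enorm (x - y) `^ (n%:R + s * p))%:E)
             * (delta_bd D x `^ beta)%:E))%E.
Proof.
have n0 : (0 < n)%N by apply: leq_trans hn.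
have [s0 _] := andP hs; have p1 := ltW hp.
have [al0] := andP halpha; rewrite lt_min => /andP[aldw _].
have p0 : 0 < p by exact: lt_trans ltr01 hp.
have q0 : 0 < q by exact: lt_le_trans p0 hpq.
have [C C0 HC] := weighted_bound n0 hc s0 p1 hpq hsp hq htau hK al0 aldw.
have Cpq0 : 0 < C `^ (p / q) by rewrite powR_gt0.
exists (C `^ (p / q)) => // D Dj ubD _ cov u [r r1 [mDu finu]].
have [x0 Dx0 _] := unbounded_far 0 0 ubD; have D0 : D !=set0 by exists x0.
have oD := john_open Dj; have DT := john_proper Dj.
have mD := open_row_measurable oD.
(* Measurability of [u] is known on [D] only; the extension by 0 is measurable on the whole
   space. *)
pose U := u \_ D.
have UD x : D x -> U x = u x by move=> Dx; rewrite /U patchE mem_set.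
have mU : measurable_fun setT U by apply/(measurable_restrictT _ mD).
have [B uB] : exists B : R,
    (\int[lebesgue_row n]_z (`|U z| `^ r)%:E <= B%:E)%E.
  have r0 : r != 0 by rewrite gt_eqF// (lt_le_trans ltr01).
  have := poweR_lty r finu; rewrite poweR_Lnorm//= => H.
  exists (fine (\int[lebesgue_row n]_z (`|U z| `^ r)%:E)); rewrite fineK//.
  by rewrite ge0_fin_numE ?integral_ge0// => x _; rewrite lee_fin powR_ge0.
have -> : (\int[lebesgue_row n]_(x in D) (`|u x| `^ q *
      delta_bd D x `^ (q / p * (n%:R - s * p + beta) - n%:R))%:E =
    \int[lebesgue_row n]_(x in D) (`|U x| `^ q *
      delta_bd D x `^ (q / p * (n%:R - s * p + beta) - n%:R))%:E)%E.
  by apply: eq_integral => x /set_mem Dx; rewrite UD.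
have -> : (\int[lebesgue_row n]_(x in D)
    (\int[lebesgue_row n]_(y in eball x (tau * delta_bd D x))
       (`|u x - u y| `^ p / enorm (x - y) `^ (n%:R + s * p))%:E *
     (delta_bd D x `^ beta)%:E) =
    \int[lebesgue_row n]_(x in D) weighted_energy s p beta tau D U x)%E.
  (* As [tau < 1], the balls of the inner integral stay in [D], where [U = u]. *)
  apply: eq_integral => x /set_mem Dx; congr (_ * _)%E.
  apply: eq_integral => y /set_mem xy; rewrite /kern !UD//.
  apply: (eball_delta_bd oD Dx); apply: lt_le_trans xy _.
  have [_ t1] := andP htau.
  by rewrite ler_piMl ?(ltW t1)// ltW// (delta_bd_gt0 oD D0 DT Dx).
set Lam := (\int[_]_(x in D) weighted_energy _ _ _ _ _ _ _)%E.
have Lam0 : (0 <= Lam)%E.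
  by apply: integral_ge0 => x _; exact: weighted_energy_ge0.
(* Stated for every real [L > 0] with [Lam <= L], because [Lam] itself may be 0 or infinite. *)
have bound L : 0 < L -> (Lam <= L%:E)%E -> ((\int[lebesgue_row n]_(x in D)
    (`|U x| `^ q * delta_bd D x `^ (q / p * (n%:R - s * p + beta) - n%:R))%:E)
    `^ (p / q) <= (C `^ (p / q) * L)%:E)%E.
  move=> L0 LL; have H := HC D U L r B Dj ubD cov mU L0 LL r1 uB.
  have I0 : (0 <= \int[lebesgue_row n]_(x in D) (`|U x| `^ q *
      delta_bd D x `^ (q / p * (n%:R - s * p + beta) - n%:R))%:E)%E.
    by apply: integral_ge0 => x _; rewrite lee_fin mulr_ge0 ?powR_ge0.
  move: I0 H; case: (\int[_]_(x in D) _)%E => [v| |]//.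
  rewrite poweR_EFin !lee_fin => v0 vL.
  have pq0 : 0 <= p / q by rewrite divr_ge0 ?(ltW p0) ?(ltW q0).
  apply: le_trans (ler_powR_base pq0 v0 vL) _.
  rewrite powRM ?(ltW C0) ?powR_ge0// -powRrM.
  by rewrite (_ : q / p * (p / q) = 1) ?powRr1 ?(ltW L0)//; field; rewrite !gt_eqF.
move: Lam0 bound; case: Lam => [l| |]// l0 bound; last first.
  by rewrite gt0_muley ?lte_fin// leey.
rewrite lee_fin in l0; apply/lee_addgt0Pr => e e0.
(* The increment of [L] that adds exactly [e] to the right side. *)
have e0' : 0 < e / C `^ (p / q) by rewrite divr_gt0.
have le : C `^ (p / q) * (l + e / C `^ (p / q)) = C `^ (p / q) * l + e.
  by field; rewrite gt_eqF.
rewrite -EFinM -EFinD -le; apply: bound; first by rewrite ltr_wpDl.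
by rewrite lee_fin lerDl ltW.
Qed.
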